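(* A linear map $T:\mathbb{C}[x]\to\mathbb{C}[x]$ belongs to $\mathcal{A}$ if and only if $T=\varphi(D)$, where $D=d/dx$ and $\varphi$ is a real entire function (in the Laguerre–Pólya class) of the form $$\varphi(x)=e^{-a^2x^2+bx}\prod_{k=1}^\infty(1-\alpha_kx)e^{\alpha_kx}$$ with $a,b,\alpha_k\in\mathbb{R}$ and $\sum_{k=1}^\infty\alpha_k^2<\infty$. In particular, $\mathcal{A}$ is a commutative monoid (under composition).
   Context: For $n\ge1$, $\mathcal{H}_n$ is the set of monic polynomials of degree $n$ with only real zeros; $\mathcal{H}_0=\{1\}$. For $n\ge 0$, $\mathcal{A}_n(\mathbb{R})$ is the set of linear maps $T:\mathbb{C}[x]\to\mathbb{C}[x]$ with $T(\mathcal{H}_n)\subseteq\mathcal{H}_n$, and $\mathcal{A}=\bigcap_{n=0}^\infty\mathcal{A}_n(\mathbb{R})$. For an entire function $\varphi(x)=\sum_{k\ge0}c_kx^k$, $\varphi(D)$ denotes the operator $P\mapsto\sum_{k\ge0}c_kP^{(k)}$ on $\mathbb{C}[x]$ (a finite sum for each polynomial $P$). *)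

(* Defs.v *)
From HB Require Import structures.
From mathcomp Require Import all_boot all_order all_algebra.
From mathcomp Require Import complex.
From mathcomp Require Import all_classical all_reals all_analysis.

Set Implicit Arguments.
Unset Strict Implicit.
Unset Printing Implicit Defensive.

Import Order.TTheory GRing.Theory Num.Theory.
Import numFieldNormedType.Exports.

Local Open Scope classical_set_scope.
Local Open Scope ring_scope.

(* Naming R[i] at type numClosedFieldType gives it the norm topology, which is
   not inferred for the bare type R[i]. *)
Definition Cplx (R : realType) : numClosedFieldType := R[i].

Definition toC (R : realType) (x : R) : Cplx R := real_complex R x.

Definition expC (R : realType) (z : Cplx R) : Cplx R :=
  let: (x +i* y)%C := z in ((expR x * cos y) +i* (expR x * sin y))%C.

(* For n = 0 this is {1}. *)
Definition hyperbolic (R : realType) (n : nat) : set {poly Cplx R} :=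
  [set p | [/\ p \is monic, size p = n.+1
             & forall z : Cplx R, root p z -> z \is Num.real]].

Definition preserver (R : realType) (n : nat) :
    set ({poly Cplx R} -> {poly Cplx R}) :=
  [set T | linear T /\ T @` @hyperbolic R n `<=` @hyperbolic R n].

Definition monic_preservers (R : realType) :
    set ({poly Cplx R} -> {poly Cplx R}) :=
  \bigcap_(n in [set: nat]) @preserver R n.

Definition power_series_expansion (R : realType)
    (phi : Cplx R -> Cplx R) (c : nat -> Cplx R) : Prop :=
  forall z : Cplx R, series (fun k => c k * z ^+ k) @ \oo --> phi z.

Definition real_entire (R : realType) (phi : Cplx R -> Cplx R) : Prop :=
  (exists c, power_series_expansion phi c) /\
  (forall x : R, phi (toC x) \is Num.real).

(* The sum stops at size p because the later derivatives of p vanish. *)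
Definition series_in_D (R : realType) (c : nat -> Cplx R)
    (p : {poly Cplx R}) : {poly Cplx R} :=
  \sum_(k < size p) c k *: p^`(k).

(* T = phi(D); the coefficient sequence c is determined by phi. *)
Definition is_function_of_D (R : realType) (phi : Cplx R -> Cplx R)
    (T : {poly Cplx R} -> {poly Cplx R}) : Prop :=
  exists c, power_series_expansion phi c /\ T =1 series_in_D c.

(* alpha is indexed from 0: alpha k belongs to the (k+1)-st factor. *)
Definition LP_product (R : realType) (alpha : nat -> R) (z : Cplx R)
    (n : nat) : Cplx R :=
  \prod_(k < n) ((1 - toC (alpha k) * z) * expC (toC (alpha k) * z)).

Definition LP_form (R : realType) (a b : R) (alpha : nat -> R)
    (phi : Cplx R -> Cplx R) : Prop :=
  cvgn (series (fun k => alpha k ^+ 2)) /\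
  forall z : Cplx R,
    cvgn (LP_product alpha z) /\
    phi z = expC (- toC a ^+ 2 * z ^+ 2 + toC b * z) * limn (LP_product alpha z).

Definition commutative_monoid (X : Type) (M : set X) (op : X -> X -> X)
    (e : X) : Prop :=
  [/\ M e,
      forall x y, M x -> M y -> M (op x y),
      forall x y z, M x -> M y -> M z -> op x (op y z) = op (op x y) z,
      forall x, M x -> op e x = x /\ op x e = x
    & forall x y, M x -> M y -> op x y = op y x].

(* Main.v *)
Require Import Defs.
From HB Require Import structures.
From mathcomp Require Import all_boot all_order all_algebra.
From mathcomp Require Import complex.
From mathcomp Require Import all_classical all_reals all_analysis.
From mathcomp Require Import ring lra zify.

(* If T preserves monic real-rooted polynomials, then T ((x + t)^n) translated
   back by t is real-rooted with degree n for all real t. The sum of squares of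
   its roots, being nonnegative, keeps them bounded as t varies, so that its
   coefficients, polynomial in t, are constant: T commutes with translations,
   hence T = phi(D). The polynomials T (x^n), reversed and rescaled by n, are
   real-rooted and converge to phi at each point; the sums of the reciprocals of
   their zeros and of the squares of these are under control, so phi is a
   Laguerre-Polya product, the Gaussian factor accounting for the squares lost in
   the limit. Conversely 1 - r D preserves real-rootedness, and phi(D) is a limit
   of products of such operators. The coefficients of phi are bounded by AM-GM on
   the roots of T (x^n), so limits of power series can be taken at each point by
   dominated convergence, without complex analysis. *)

Import Order.TTheory GRing.Theory Num.Theory.
Import numFieldNormedType.Exports.
Local Open Scope classical_set_scope.
Local Open Scope ring_scope.

Set Implicit Arguments.
Unset Strict Implicit.
Unset Printing Implicit Defensive.

(** * Convergence in the complex field *)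

(** Two real numbers control a whole preserver phi(D): c 1 and c 1 ^+ 2 - 2 * c 2, where c is the
    coefficient sequence. Through the first two power sums of the roots of the images of x^n, they
    bound every coefficient, so a single summable majorant serves for all sequences for which these
    two numbers are bounded. The delicate point of the converse is that the approximating
    polynomials are known to converge to phi only pointwise, whereas the operators need convergence
    of the coefficients, usually read off from Cauchy's formula. Here the majorant makes the
    coefficients converge along an ultrafilter, dominated convergence shows that their limits expand
    phi, and uniqueness of power series identifies these limits with the coefficients of phi. In the
    direct part the obstacle is that the reciprocal zeros converge one by one only. The tail is
    controlled by factors of genus 2: cubes of small numbers with bounded sum of squares are
    negligible, squares are not. *)

HB.instance Definition _ (R : realType) :=
  GRing.RMorphism.copy (@toC R) (real_complex R).

(** The norm of [Cplx R] takes values in [Cplx R] itself; this is the same modulus as a real number,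
    so that real series, [expR] and [lra] apply to it. *)
Definition cabs (R : realType) (z : Cplx R) : R := complex.Re `|z|.

Section ComplexModulus.
Variable R : realType.
Implicit Types (x y : R) (z w : Cplx R).

Lemma cabsE z : toC (cabs z) = `|z|.
Proof. by rewrite /cabs /toC normc_def. Qed.

Lemma toC_inj : injective (@toC R).
Proof. by move=> x y [->]. Qed.

Lemma toC_real x : toC x \is Num.real.
Proof. by apply/complex_realP; exists x. Qed.

Lemma le_toC x y : (toC x <= toC y) = (x <= y).
Proof. exact: lecR. Qed.

Lemma lt_toC x y : (toC x < toC y) = (x < y).
Proof. exact: ltcR. Qed.

Lemma cabs_ge0 z : 0 <= cabs z.
Proof. by rewrite -le_toC cabsE rmorph0 normr_ge0. Qed.

Lemma cabsM z w : cabs (z * w) = cabs z * cabs w.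
Proof. by apply: toC_inj; rewrite rmorphM /= !cabsE normrM. Qed.

Lemma cabsD z w : cabs (z + w) <= cabs z + cabs w.
Proof. by rewrite -le_toC rmorphD /= !cabsE ler_normD. Qed.

Lemma cabsN z : cabs (- z) = cabs z.
Proof. by apply: toC_inj; rewrite !cabsE normrN. Qed.

Lemma cabsB z w : cabs (z - w) <= cabs z + cabs w.
Proof. by rewrite -(cabsN w) cabsD. Qed.

Lemma cabs_distC z w : cabs (z - w) = cabs (w - z).
Proof. by rewrite -opprB cabsN. Qed.

Lemma cabs0 : cabs (0 : Cplx R) = 0.
Proof. by apply: toC_inj; rewrite cabsE normr0 rmorph0. Qed.

Lemma cabs1 : cabs (1 : Cplx R) = 1.
Proof. by apply: toC_inj; rewrite cabsE normr1 rmorph1. Qed.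

Lemma cabs_eq0 z : (cabs z == 0) = (z == 0).
Proof. by rewrite -(inj_eq toC_inj) cabsE rmorph0 normr_eq0. Qed.

Lemma cabsX z n : cabs (z ^+ n) = cabs z ^+ n.
Proof. by apply: toC_inj; rewrite rmorphXn /= !cabsE normrX. Qed.

Lemma cabs_toC x : cabs (toC x) = `|x|.
Proof.
by rewrite /cabs /toC normc_def /= expr0n addr0 sqrtr_sqr.
Qed.

Lemma cabs_sum (I : Type) (r : seq I) (P : pred I) (f : I -> Cplx R) :
  cabs (\sum_(i <- r | P i) f i) <= \sum_(i <- r | P i) cabs (f i).
Proof.
by rewrite -le_toC rmorph_sum /= cabsE (le_trans (ler_norm_sum _ _ _)) //;
  apply: ler_sum => i _; rewrite cabsE.
Qed.

Lemma cabs_prod (I : Type) (r : seq I) (P : pred I) (f : I -> Cplx R) :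
  cabs (\prod_(i <- r | P i) f i) = \prod_(i <- r | P i) cabs (f i).
Proof.
by apply: toC_inj; rewrite rmorph_prod /= cabsE normr_prod;
  apply: eq_bigr => i _; rewrite cabsE.
Qed.

Lemma Re_le_cabs z : `|complex.Re z| <= cabs z.
Proof.
rewrite /cabs normc_def /= -sqrtr_sqr ler_sqrt ?lerDl ?sqr_ge0 //.
by rewrite addr_ge0 ?sqr_ge0.
Qed.

Lemma Im_le_cabs z : `|complex.Im z| <= cabs z.
Proof.
rewrite /cabs normc_def /= -sqrtr_sqr ler_sqrt ?lerDr ?sqr_ge0 //.
by rewrite addr_ge0 ?sqr_ge0.
Qed.

Lemma cabs_le_ReIm z : cabs z <= `|complex.Re z| + `|complex.Im z|.
Proof.
have -> : z = toC (complex.Re z) + 'i%C * toC (complex.Im z).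
  by rewrite [LHS]complexE.
rewrite (le_trans (cabsD _ _)) // cabsM !cabs_toC.
have -> : cabs 'i%C = 1 :> R.
  by rewrite /cabs normc_def /= expr0n expr1n add0r sqrtr1.
by rewrite mul1r /toC /= !mul0r !mul1r !subr0 !addr0 !add0r.
Qed.

Lemma cvgC_distP (T : Type) (F : set_system T) {FF : Filter F}
    (f : T -> Cplx R) (l : Cplx R) :
  f @ F --> l <-> forall e : R, 0 < e -> \forall t \near F, cabs (f t - l) < e.
Proof.
split=> [/cvgrPdist_lt H e e0|H].
  have := H (toC e); rewrite -(rmorph0 (@toC R)) lt_toC => /(_ e0).
  by apply: filterS => t /=; rewrite -cabsE lt_toC cabs_distC.
apply/cvgrPdist_lt => e e0.
have eR : e = toC (complex.Re e).
  by rewrite /toC RRe_real // realE (ltW e0).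
have e0' : 0 < complex.Re e by rewrite -lt_toC -eR rmorph0.
have := H _ e0'; apply: filterS => t /=.
by rewrite -cabsE {2}eR lt_toC cabs_distC.
Qed.

Lemma cvgCE (T : Type) (F : set_system T) {FF : Filter F}
    (f : T -> Cplx R) (l : Cplx R) :
  f @ F --> l <-> (fun t => cabs (f t - l)) @ F --> (0 : R).
Proof.
split=> [/cvgC_distP H|/cvgrPdist_lt H].
  apply/cvgrPdist_lt => e e0; have := H _ e0; apply: filterS => t.
  by rewrite sub0r normrN ger0_norm ?cabs_ge0.
apply/cvgC_distP => e e0; have := H _ e0; apply: filterS => t.
by rewrite sub0r normrN ger0_norm ?cabs_ge0.
Qed.

Lemma squeeze_cvg0 (T : Type) (F : set_system T) {FF : Filter F}
    (f g : T -> R) :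
  (\forall t \near F, 0 <= f t <= g t) -> g @ F --> (0 : R) ->
  f @ F --> (0 : R).
Proof.
by move=> H; apply: (@squeeze_cvgr _ _ _ _ (fun=> 0) g f H 0); exact: cvg_cst.
Qed.

Lemma cvg_cabs_le (T : Type) (F : set_system T) {FF : Filter F}
    (f : T -> Cplx R) (l : Cplx R) (g : T -> R) :
  (\forall t \near F, cabs (f t - l) <= g t) -> g @ F --> (0 : R) ->
  f @ F --> l.
Proof.
move=> H g0; apply/cvgCE; apply: squeeze_cvg0 g0.
by apply: filterS H => t ->; rewrite cabs_ge0.
Qed.

Lemma cvg_toC (T : Type) (F : set_system T) {FF : Filter F}
    (f : T -> R) (l : R) :
  f @ F --> l -> (fun t => toC (f t)) @ F --> toC l.
Proof.
move=> H; apply/cvgCE.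
under eq_fun do rewrite -rmorphB /= cabs_toC.
by apply/norm_cvg0P; exact/subr_cvg0.
Qed.

Lemma cvg_cabs (T : Type) (F : set_system T) {FF : Filter F}
    (f : T -> Cplx R) (l : Cplx R) :
  f @ F --> l -> (fun t => cabs (f t)) @ F --> cabs l.
Proof.
move=> /cvgCE H; apply/subr_cvg0; apply: norm_cvg0.
apply: squeeze_cvg0 H; near=> t; rewrite normr_ge0 ler_norml.
have H1 := cabsD (f t - l) l; rewrite subrK in H1.
have H2 := cabsD (l - f t) (f t); rewrite subrK cabs_distC in H2.
by rewrite lerBlDr H1 andbT lerNl opprB lerBlDr.
Unshelve. all: by end_near. Qed.

Lemma cvg_Re (T : Type) (F : set_system T) {FF : Filter F}
    (f : T -> Cplx R) (l : Cplx R) :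
  f @ F --> l -> (fun t => complex.Re (f t)) @ F --> complex.Re l.
Proof.
move=> /cvgCE H; apply/subr_cvg0; apply: norm_cvg0.
apply: squeeze_cvg0 H; near=> t; rewrite normr_ge0.
have -> : complex.Re (f t) - complex.Re l = complex.Re (f t - l).
  by case: (f t) l => [a b] [c d].
exact: Re_le_cabs.
Unshelve. all: by end_near. Qed.

Lemma cvg_Im (T : Type) (F : set_system T) {FF : Filter F}
    (f : T -> Cplx R) (l : Cplx R) :
  f @ F --> l -> (fun t => complex.Im (f t)) @ F --> complex.Im l.
Proof.
move=> /cvgCE H; apply/subr_cvg0; apply: norm_cvg0.
apply: squeeze_cvg0 H; near=> t; rewrite normr_ge0.
have -> : complex.Im (f t) - complex.Im l = complex.Im (f t - l).
  by case: (f t) l => [a b] [c d].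
exact: Im_le_cabs.
Unshelve. all: by end_near. Qed.

Lemma cvg_complex (T : Type) (F : set_system T) {FF : Filter F}
    (f g : T -> R) (a b : R) :
  f @ F --> a -> g @ F --> b ->
  (fun t => (f t +i* g t)%C : Cplx R) @ F --> ((a +i* b)%C : Cplx R).
Proof.
move=> /subr_cvg0 fa /subr_cvg0 gb.
have {}fa := iffRL (@norm_cvg0P _ _ _ _ FF _) fa.
have {}gb := iffRL (@norm_cvg0P _ _ _ _ FF _) gb.
apply: (@cvg_cabs_le _ _ _ _ _ (fun t => `|f t - a| + `|g t - b|)).
  by near=> t; exact: cabs_le_ReIm.
have := cvgD fa gb; rewrite addr0 => H; exact: H.
Unshelve. all: by end_near. Qed.

Lemma cvgCD (T : Type) (F : set_system T) {FF : Filter F}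
    (f g : T -> Cplx R) (a b : Cplx R) :
  f @ F --> a -> g @ F --> b -> (fun t => f t + g t) @ F --> a + b.
Proof. by move=> fa gb; exact: (@cvgD _ _ _ F FF f g a b fa gb). Qed.

Lemma cvgCB (T : Type) (F : set_system T) {FF : Filter F}
    (f g : T -> Cplx R) (a b : Cplx R) :
  f @ F --> a -> g @ F --> b -> (fun t => f t - g t) @ F --> a - b.
Proof. by move=> fa gb; exact: (@cvgB _ _ _ F FF f g a b fa gb). Qed.

Lemma cvgCM (T : Type) (F : set_system T) {FF : Filter F}
    (f g : T -> Cplx R) (a b : Cplx R) :
  f @ F --> a -> g @ F --> b -> (fun t => f t * g t) @ F --> a * b.
Proof. by move=> fa gb; exact: (@cvgM _ _ F FF f g a b fa gb). Qed.

Lemma cvgC_unique (T : Type) (F : set_system T) {FF : ProperFilter F}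
    (f : T -> Cplx R) (l l' : Cplx R) : f @ F --> l -> f @ F --> l' -> l = l'.
Proof. by move=> fl fl'; apply: (cvg_unique _ fl fl'). Qed.

(* Cplx R has no instance of completeness, hence the detour through real and
   imaginary parts. *)
Lemma is_cvg_series_cabs (u : nat -> Cplx R) (v : nat -> R) :
  (forall n, cabs (u n) <= v n) -> cvgn (series v) -> cvgn (series u).
Proof.
move=> uv cv.
have v0 n : 0 <= v n by exact: le_trans (cabs_ge0 _) (uv n).
have cre : cvgn (series (fun n => complex.Re (u n))).
  apply: normed_cvg; apply: (series_le_cvg _ v0 _ cv) => n.
    exact: normr_ge0.
  exact: le_trans (Re_le_cabs _) (uv n).
have cim : cvgn (series (fun n => complex.Im (u n))).
  apply: normed_cvg; apply: (series_le_cvg _ v0 _ cv) => n.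
    exact: normr_ge0.
  exact: le_trans (Im_le_cabs _) (uv n).
apply/cvg_ex; exists (limn (series (fun n => complex.Re (u n)))
  +i* limn (series (fun n => complex.Im (u n))))%C.
have -> : series u = fun n => (series (fun n => complex.Re (u n)) n
   +i* series (fun n => complex.Im (u n)) n)%C.
  apply/funext; elim=> [|n IH]; first by rewrite /series /= !big_geq.
  by rewrite !seriesSr IH; case: (u n).
exact: cvg_complex.
Qed.

End ComplexModulus.

(** * Ultrafilter limits, dominated convergence and infinite products *)

Section Limits.
Variable R : realType.

(* Limits along a fixed ultrafilter replace the extraction of diagonal
   subsequences. *)
Lemma ultrafilter_at_infinity : exists2 U : set_system nat,
  ProperFilter U /\ \oo `<=` U &
  forall (u : nat -> R) (B : R), (forall n, `|u n| <= B) ->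
    exists l : R, u @ U --> l.
Proof.
have [U [UU ooU]] := @ultraFilterLemma nat \oo _.
have PU : ProperFilter U by exact: ultra_proper.
exists U => // u B uB.
have [p [_ clp]] : `[- B, B]%classic `&` cluster (u @ U) !=set0.
  apply: (@segment_compact R (- B) B (u @ U)).
  rewrite /fmap /=; apply: filterE => n /=.
  by rewrite in_itv /= -ler_norml.
exists p => V Vp.
have [//|UVC] := in_ultra_setVsetC (u @^-1` V) UU.
have UVC' : (u @ U) (~` V) by exact: UVC.
by have [x [? ?]] := clp _ _ UVC' Vp.
Qed.

Lemma cvg_series_param (T : Type) (F : set_system T) {FF : Filter F}
    (f : T -> nat -> Cplx R) (h : nat -> Cplx R) m :
  (forall k, f t k @[t --> F] --> h k) ->
  series (f t) m @[t --> F] --> series h m.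
Proof.
move=> fh; elim: m => [|m IH].
  have S0 (u : nat -> Cplx R) : series u 0 = 0 by rewrite /series /= big_geq.
  by rewrite S0; under eq_fun do rewrite S0; exact: cvg_cst.
rewrite seriesSr; under eq_fun do rewrite seriesSr.
exact: (cvgCD IH (fh m)).
Qed.

Lemma cabs_series_tail (u : nat -> Cplx R) (g : nat -> R) m n : (m <= n)%N ->
  (forall k, cabs (u k) <= g k) ->
  cabs (series u n - series u m) <= series g n - series g m.
Proof.
move=> mn ug; rewrite !sub_series_geq // (le_trans (cabs_sum _ _ _)) //.
exact: ler_sum.
Qed.

Lemma series_le_limn (g : nat -> R) m : (forall k, 0 <= g k) ->
  cvgn (series g) -> series g m <= limn (series g).
Proof.
by move=> g0 cg; apply: nondecreasing_cvgn_le => //; apply/nondecreasing_series.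
Qed.

(** Dominated convergence for series. Past an index m where the tail of [g] is below e / 4, the
    tails of [f t] and [h] are negligible uniformly in t, and the first m terms converge. The filter
    is arbitrary because the result serves along [\oo] and along an ultrafilter. *)
Lemma tannery (T : Type) (F : set_system T) {FF : ProperFilter F}
    (f : T -> nat -> Cplx R) (h : nat -> Cplx R) (g : nat -> R)
    (S : T -> Cplx R) (l : Cplx R) :
  (forall t k, cabs (f t k) <= g k) -> cvgn (series g) ->
  (forall k, f t k @[t --> F] --> h k) ->
  (forall t, series (f t) @ \oo --> S t) ->
  series h @ \oo --> l -> S @ F --> l.
Proof.
move=> fg cg fh fS hl.
have g0 k : 0 <= g k.
  have [t _] := @filter_ex _ F _ setT filterT.
  exact: le_trans (cabs_ge0 _) (fg t k).
have hg k : cabs (h k) <= g k.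
  have /cvg_cabs H := fh k.
  by apply: (cvgr_to_le H); exact: nearW.
have tail (u : nat -> Cplx R) (v : Cplx R) m : (forall k, cabs (u k) <= g k) ->
    series u @ \oo --> v ->
    cabs (v - series u m) <= limn (series g) - series g m.
  move=> ug uv.
  have /cvg_cabs H : (fun n => series u n - series u m) @ \oo -->
      v - series u m.
    by apply: (cvgCB uv); exact: cvg_cst.
  apply: (cvgr_to_le H); exists m => // n /= mn.
  rewrite (le_trans (cabs_series_tail mn ug)) // lerB //.
  exact: series_le_limn.
apply/cvgC_distP => e e0.
have e4 : 0 < e / 4 by lra.
have [m _ Hm] : \forall m \near \oo, limn (series g) - series g m < e / 4.
  have /cvgrPdist_lt /(_ _ e4) := cg.
  by apply: filterS => n; apply: le_lt_trans (ler_norm _).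
have {}Hm := Hm m (leqnn m).
have /cvgC_distP /(_ _ e4) := cvg_series_param (FF := FF) (m := m) fh.
apply: filterS => t H1.
have H2 := tail _ _ m (fg t) (fS t).
have H3 := tail _ _ m hg hl.
have -> : S t - l = (S t - series (f t) m) + (series (f t) m - series h m)
   - (l - series h m) by ring.
rewrite (le_lt_trans (cabsB _ _)) //.
have := cabsD (S t - series (f t) m) (series (f t) m - series h m).
by lra.
Qed.

(** Induction through (1 + u) p - 1 = (p - 1) + u p, with 1 + |u| <= exp |u|. *)
Lemma cabs_prod_sub1 (I : Type) (r : seq I) (P : pred I) (u : I -> Cplx R) :
  cabs (\prod_(i <- r | P i) (1 + u i) - 1) <=
  expR (\sum_(i <- r | P i) cabs (u i)) - 1.
Proof.
elim: r => [|i r IH]; first by rewrite !big_nil subrr cabs0 expR0 subrr.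
rewrite !big_cons; case: (P i) => //.
move: IH; set p := \prod_(j <- _ | _) _; set s := \sum_(j <- _ | _) _ => IH.
have -> : (1 + u i) * p - 1 = (p - 1) + u i * p by ring.
rewrite (le_trans (cabsD _ _)) // cabsM.
have ps : cabs p <= expR s.
  by have := cabsD (p - 1) 1; rewrite subrK cabs1; lra.
have u0 := cabs_ge0 (u i).
rewrite expRD.
have : (1 + cabs (u i)) * expR s <= expR (cabs (u i)) * expR s.
  by rewrite ler_wpM2r ?expR_ge0 // expR_ge1Dx.
have : cabs (u i) * cabs p <= cabs (u i) * expR s by rewrite ler_wpM2l.
by lra.
Qed.

(** The increments P (k + 1) - P k = P k * u k turn the product into a series, which converges
    absolutely because the partial products are bounded by the exponential of the sum of the |u
    k|. *)
Lemma is_cvg_prod_1D (u : nat -> Cplx R) :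
  cvgn (series (fun k => cabs (u k))) ->
  cvgn (fun n => \prod_(k < n) (1 + u k)).
Proof.
move=> cu; set P := fun n => _.
have PE : P = fun n => 1 + series (fun k => P k * u k) n.
  apply/funext; elim=> [|n IH].
    by rewrite /P /series /= big_ord0 big_geq // addr0.
  by rewrite seriesSr addrA -IH /P big_ord_recr /= mulrDr mulr1.
set L := limn (series (fun k => cabs (u k))).
have c0 k : 0 <= cabs (u k) by exact: cabs_ge0.
have Pb n : cabs (P n) <= expR L.
  have := cabsD (P n - 1) 1; rewrite subrK cabs1 => H.
  have := cabs_prod_sub1 (index_enum 'I_n) xpredT (fun k : 'I_n => u k).
  rewrite -(big_mkord xpredT (fun k => cabs (u k))) => H2.
  have : expR (series (fun k => cabs (u k)) n) <= expR L.
    by rewrite ler_expR; exact: series_le_limn.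
  by move: H H2; rewrite /P /series /=; lra.
rewrite PE.
have /cvg_ex[l Hl] : cvgn (series (fun k => P k * u k)).
  apply: (@is_cvg_series_cabs _ _ (fun k => expR L * cabs (u k))).
    by move=> n; rewrite cabsM ler_wpM2r.
  exact: is_cvg_seriesZ.
apply/cvg_ex; exists (1 + l).
by apply: (cvgCD _ Hl); exact: cvg_cst.
Qed.

End Limits.

(** * The complex exponential near zero *)

Section ComplexExponential.
Variable R : realType.
Implicit Types (x y : R) (z w : Cplx R).

Lemma expC_toC x : expC (toC x) = toC (expR x).
Proof. by rewrite /expC /toC /= cos0 sin0 mulr1 mulr0. Qed.

Lemma expC0 : expC (0 : Cplx R) = 1.
Proof. by rewrite -(rmorph0 (@toC R)) expC_toC expR0 rmorph1. Qed.

Lemma expCD z w : expC (z + w) = expC z * expC w.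
Proof.
case: z w => [a b] [c d]; rewrite /expC /=; simpc.
by rewrite expRD cosD sinD; congr (_ +i* _)%C; ring.
Qed.

Lemma expC_sum (I : Type) (r : seq I) (P : pred I) (f : I -> Cplx R) :
  expC (\sum_(i <- r | P i) f i) = \prod_(i <- r | P i) expC (f i).
Proof. exact: (big_morph _ expCD expC0). Qed.

Lemma expCMn z n : expC (z *+ n) = expC z ^+ n.
Proof.
by elim: n => [|n IH]; rewrite ?mulr0n ?expC0 // mulrS expCD IH exprS.
Qed.

Lemma cabs_expC z : cabs (expC z) <= expR (cabs z).
Proof.
case: z => a b; apply: (@le_trans _ _ (expR a)).
  rewrite /cabs normc_def /= !exprMn -mulrDr cos2Dsin2 mulr1 sqrtr_sqr.
  by rewrite ger0_norm ?expR_ge0.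
rewrite ler_expR; exact: le_trans (ler_norm _) (Re_le_cabs (a +i* b)%C).
Qed.

Lemma cvg_expC (T : Type) (F : set_system T) {FF : Filter F}
    (f : T -> Cplx R) (l : Cplx R) :
  f @ F --> l -> (fun t => expC (f t)) @ F --> expC l.
Proof.
move=> fl; have fR := cvg_Re (FF := FF) fl; have fI := cvg_Im (FF := FF) fl.
have -> : (fun t => expC (f t)) = fun t =>
    (expR (complex.Re (f t)) * cos (complex.Im (f t)) +i*
     (expR (complex.Re (f t)) * sin (complex.Im (f t))))%C.
  by apply/funext => t; case: (f t).
case: l fl fR fI => a b _ fR fI; rewrite /expC.
apply: cvg_complex.
  apply: cvgM; first exact: (cvg_comp _ _ fR (@continuous_expR R a)).
  exact: (cvg_comp _ _ fI (@continuous_cos R b)).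
apply: cvgM; first exact: (cvg_comp _ _ fR (@continuous_expR R a)).
exact: (cvg_comp _ _ fI (@continuous_sin R b)).
Qed.

(** The remainder is dominated by a geometric series of sum |x|^3 / (1 - |x|), at most 2 |x|^3
    here. *)
Lemma series_taylor2 (u : nat -> R) (l x : R) : `|x| <= 1 / 2 ->
  (forall k, `|u k| <= `|x| ^+ k) -> series u @ \oo --> l ->
  `|l - (u 0 + u 1 + u 2)| <= 2 * `|x| ^+ 3.
Proof.
move=> x2 ux ul.
have H : (fun n => `|series u n - (u 0 + u 1 + u 2)|) @ \oo -->
    `|l - (u 0 + u 1 + u 2)|.
  by apply: cvg_norm; apply: cvgB => //; exact: cvg_cst.
apply: (cvgr_to_le H); exists 3 => // n /= n3.
have -> : u 0 + u 1 + u 2 = series u 3.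
  by rewrite !seriesSr /series /= big_geq // add0r.
rewrite sub_series_geq // (le_trans (ler_norm_sum _ _ _)) //.
have : \sum_(3 <= k < n) `|u k| <= \sum_(3 <= k < n) `|x| ^+ k.
  by apply: ler_sum.
move/le_trans; apply.
rewrite -(subnKC n3) -{1}[3%N]add0n big_addn addKn.
under eq_bigr do rewrite exprD.
rewrite -mulr_suml ler_wpM2r ?exprn_ge0 //.
have := subrX1 `|x| (n - 3); rewrite big_mkord.
set s := \sum_(i < _) _ => E.
have s0 : 0 <= s by apply: sumr_ge0 => i _; rewrite exprn_ge0.
have : 0 <= `|x| ^+ (n - 3) by rewrite exprn_ge0.
by nra.
Qed.

Lemma expR_taylor2 x : `|x| <= 1 / 2 ->
  `|expR x - (1 + x + x ^+ 2 / 2)| <= 2 * `|x| ^+ 3.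
Proof.
move=> x2; have H := @series_taylor2 (exp_coeff x) (expR x) x x2.
have -> : 1 + x + x ^+ 2 / 2 = exp_coeff x 0 + exp_coeff x 1 + exp_coeff x 2.
  by rewrite /exp_coeff /= !expr0 !expr1 !fact0 !divr1.
apply: H => [k|]; last exact: is_cvg_series_exp_coeff.
rewrite /exp_coeff /= normrM normrX normfV ler_piMr ?exprn_ge0 //.
by rewrite normr_nat invf_le1 ?ltr0n ?fact_gt0 // ler1n fact_gt0.
Qed.

Lemma cos_taylor2 x : `|x| <= 1 / 2 ->
  `|cos x - (1 - x ^+ 2 / 2)| <= 2 * `|x| ^+ 3.
Proof.
move=> x2; have H := @series_taylor2 (cos_coeff x) (cos x) x x2.
have -> : 1 - x ^+ 2 / 2 = cos_coeff x 0 + cos_coeff x 1 + cos_coeff x 2.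
  rewrite /cos_coeff /= !expr0 !expr1 !fact0 !divr1.
  by rewrite !mul0r !mul1r addr0 mulN1r mulNr.
apply: H => [k|]; last by rewrite cos.unlock; exact: is_cvg_series_cos_coeff.
rewrite /cos_coeff /= !normrM normrX normfV.
rewrite normrX normrN1 expr1n mulr1 !normr_nat.
have f1 : (k`!%:R : R)^-1 <= 1.
  by rewrite invf_le1 ?ltr0n ?fact_gt0 // ler1n fact_gt0.
have f0 : 0 <= (k`!%:R : R)^-1 by rewrite invr_ge0 ler0n.
have p0 : 0 <= `|x| ^+ k by rewrite exprn_ge0.
by case: (odd k) => /=; rewrite ?mul0r ?mul1r //; nra.
Qed.

Lemma sin_taylor2 x : `|x| <= 1 / 2 -> `|sin x - x| <= 2 * `|x| ^+ 3.
Proof.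
move=> x2; have H := @series_taylor2 (sin_coeff x) (sin x) x x2.
have {2}-> : x = sin_coeff x 0 + sin_coeff x 1 + sin_coeff x 2.
  rewrite /sin_coeff /= !expr0 !expr1 !divr1.
  by rewrite !mul0r !mul1r addr0 add0r.
apply: H => [k|]; last by rewrite sin.unlock; exact: is_cvg_series_sin_coeff.
rewrite /sin_coeff /= !normrM normrX normfV.
rewrite normrX normrN1 expr1n mulr1 !normr_nat.
have f1 : (k`!%:R : R)^-1 <= 1.
  by rewrite invf_le1 ?ltr0n ?fact_gt0 // ler1n fact_gt0.
have f0 : 0 <= (k`!%:R : R)^-1 by rewrite invr_ge0 ler0n.
have p0 : 0 <= `|x| ^+ k by rewrite exprn_ge0.
by case: (odd k) => /=; rewrite ?mul0r ?mul1r //; nra.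
Qed.

End ComplexExponential.

(** * Weierstrass factors of genus 1 and 2 *)

Section ExponentialFactors.
Variable R : realType.
Implicit Types (x y : R) (z w : Cplx R).

(** As [expC] is built from [expR], [cos] and [sin], the real and imaginary parts are estimated
    separately from the real Taylor bounds; each is at most 7 |z|^3, whence 14. *)
Lemma expC_taylor2 z : cabs z <= 1 / 2 ->
  cabs (expC z - (1 + z + z ^+ 2 / 2)) <= 14 * cabs z ^+ 3.
Proof.
move=> z2; have s0 := cabs_ge0 z.
case: z z2 s0 => a b; set s := cabs _ => z2 s0.
have as_ : `|a| <= s by exact: (Re_le_cabs (a +i* b)%C).
have bs : `|b| <= s by exact: (Im_le_cabs (a +i* b)%C).
have cub y : `|y| <= s -> `|y| ^+ 3 <= s ^+ 3.
  by move=> ys; rewrite lerXn2r ?nnegrE.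
have := expR_taylor2 (le_trans as_ z2).
have := cos_taylor2 (le_trans bs z2).
have := sin_taylor2 (le_trans bs z2).
have := cos_le1 b; have := cos_geN1 b; have := sin_le1 b; have := sin_geN1 b.
have -> : expC (a +i* b)%C - (1 + (a +i* b)%C + (a +i* b)%C ^+ 2 / 2) =
  ((expR a * cos b - (1 + a + (a ^+ 2 - b ^+ 2) / 2)) +i*
   (expR a * sin b - (b + a * b)))%C :> Cplx R.
  have -> : (2 : Cplx R)^-1 = (2^-1 +i* 0)%C.
    by rewrite -[RHS]/(toC 2^-1) fmorphV rmorph_nat.
  rewrite /expC expr2 -[1 in LHS]/((1 +i* 0)%C); simpc.
  by congr (_ +i* _)%C; field.
move: (cub _ as_) (cub _ bs).
move: (expR a) (cos b) (sin b) => X c d ca cb d1 d2 c1 c2.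
set s3 := s ^+ 3 in ca cb *.
have s30 : 0 <= s3 by rewrite exprn_ge0.
move=> H3 H2 H1; rewrite (le_trans (cabs_le_ReIm _)) //=.
pose r1 := X - (1 + a + a ^+ 2 / 2).
pose r2 := c - (1 - b ^+ 2 / 2).
pose r3 := d - b.
have {ca}H1 : `|r1| <= 2 * s3 by rewrite /r1; lra.
have {}H2 : `|r2| <= 2 * s3 by rewrite /r2; lra.
have {cb}H3 : `|r3| <= 2 * s3 by rewrite /r3; lra.
have q2 : `|1 + a + a ^+ 2 / 2| <= 2.
  by move: as_; rewrite !ler_norml => /andP[]; nra.
have dn : `|d| <= 1 by rewrite ler_norml d1.
have cn : `|c| <= 1 by rewrite ler_norml c1.
have sq y : `|y| <= s -> `|y| ^+ 2 <= s ^+ 2.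
  by move=> ys; rewrite lerXn2r ?nnegrE.
have M u v p q : `|u| <= p -> `|v| <= q -> `|u * v : R| <= p * q.
  by move=> up vq; rewrite normrM ler_pM.
have s32 : s * s ^+ 2 = s3 by rewrite -exprS.
have ab2 : `|a * b ^+ 2| <= s3 by rewrite -s32 M // normrX sq.
have a2b : `|b * a ^+ 2| <= s3 by rewrite -s32 M // normrX sq.
have a2b2 : `|a * (a * b ^+ 2)| <= 1 / 2 * s3 by rewrite M //; lra.
have m1 := M _ _ _ _ H1 cn; have m2 := M _ _ _ _ q2 H2.
have m3 := M _ _ _ _ H1 dn; have m4 := M _ _ _ _ q2 H3.
have -> : X * c - (1 + a + (a ^+ 2 - b ^+ 2) / 2) =
  r1 * c + (1 + a + a ^+ 2 / 2) * r2 - a * b ^+ 2 / 2 - a * (a * b ^+ 2) / 4.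
  by rewrite /r1 /r2; field.
have -> : X * d - (b + a * b) = r1 * d + (1 + a + a ^+ 2 / 2) * r3 +
    b * a ^+ 2 / 2.
  by rewrite /r1 /r3; field.
move: m1 m2 m3 m4 ab2 a2b a2b2.
move: (r1 * c) (_ * r2) (r1 * d) (_ * r3) (a * (a * b ^+ 2)) (a * b ^+ 2)
  (b * a ^+ 2) => t1 t2 t3 t4 t5 t6 t7.
rewrite !ler_norml => /andP[? ?] /andP[? ?] /andP[? ?] /andP[? ?] /andP[? ?]
  /andP[? ?] /andP[? ?].
have -> : 14 * s3 = 7 * s3 + 7 * s3 by ring.
apply: lerD; rewrite ler_norml; apply/andP; split; lra.
Qed.

Lemma factor1_near0 z : cabs z <= 1 / 2 ->
  cabs ((1 - z) * expC z - 1) <= 23 * cabs z ^+ 2.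
Proof.
move=> z2; have s0 := cabs_ge0 z; have H := expC_taylor2 z2.
set r := expC z - _ in H.
have -> : (1 - z) * expC z - 1 = (1 - z) * r - z ^+ 2 / 2 - z ^+ 3 / 2.
  by rewrite /r; field.
have h2 : cabs (2^-1 : Cplx R) = 1 / 2.
  by rewrite -(rmorph_nat (@toC R)) -fmorphV cabs_toC ger0_norm // div1r.
have H1 := cabsB ((1 - z) * r - z ^+ 2 / 2) (z ^+ 3 / 2).
have H2 := cabsB ((1 - z) * r) (z ^+ 2 / 2).
have H3 := cabsB 1 z.
have e2 k : cabs (z ^+ k / 2) = cabs z ^+ k * (1 / 2).
  by rewrite (cabsM (z ^+ k)) cabsX h2.
move: H1 H2 H3; rewrite !e2 (cabsM (1 - z)) cabs1 => H1 H2 H3.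
have : cabs (1 - z) * cabs r <= (3 / 2) * (14 * cabs z ^+ 3).
  by rewrite ler_pM ?cabs_ge0 //; lra.
have : cabs z ^+ 3 <= 1 / 2 * cabs z ^+ 2.
  by rewrite exprS ler_wpM2r ?exprn_ge0.
have : 0 <= cabs z ^+ 2 by rewrite exprn_ge0.
by move: H1 H2; move: (cabs z ^+ 2) (cabs z ^+ 3) => *; lra.
Qed.

(** Where |z| > 1 / 2 the left side is at most (1 + |rho|) exp |rho| + 1, and 1 <= 4 |z|^2: this is
    the second summand of the constant, the first one being that of [factor1_near0]. *)
Lemma factor1_bound (rho : R) : exists C : R, 0 <= C /\
  forall z, cabs z <= rho -> cabs ((1 - z) * expC z - 1) <= C * cabs z ^+ 2.
Proof.
exists (23 + 4 * ((1 + `|rho|) * expR `|rho| + 1)).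
have E0 : 0 <= (1 + `|rho|) * expR `|rho|.
  by rewrite mulr_ge0 ?expR_ge0 // addr_ge0.
split=> [|z zr]; first by lra.
have s0 := cabs_ge0 z.
have [z2|z2] := leP (cabs z) (1 / 2).
  rewrite (le_trans (factor1_near0 z2)) // ler_wpM2r ?exprn_ge0 //; lra.
have zr' : cabs z <= `|rho| by exact: le_trans zr (ler_norm _).
have H1 := cabsB ((1 - z) * expC z) 1; have H2 := cabsB 1 z.
move: H1 H2; rewrite cabsM cabs1 => H1 H2.
have : cabs (1 - z) * cabs (expC z) <= (1 + `|rho|) * expR `|rho|.
  rewrite ler_pM ?cabs_ge0 //; first by lra.
  by rewrite (le_trans (cabs_expC z)) // ler_expR.
move: H1 E0; set E := _ * expR _ => H1 E0 H3.
have q : 1 <= 4 * cabs z ^+ 2 by nra.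
have : (E + 1) * 1 <= (E + 1) * (4 * cabs z ^+ 2) by rewrite ler_wpM2l //; lra.
have : 0 <= cabs z ^+ 2 by rewrite exprn_ge0.
by move: H1; nra.
Qed.

(** The genus 2 factor gains one order over genus 1. A sum of |a|^3 is at most the maximum of the
    |a| times the sum of the a^2, hence small for a tail of small a whose squares are merely bounded
    in sum. *)
Lemma factor2_near0 z : cabs z <= 1 / 4 ->
  cabs ((1 - z) * expC (z + z ^+ 2 / 2) - 1) <= 200 * cabs z ^+ 3.
Proof.
move=> z4; have s0 := cabs_ge0 z; set v := z + z ^+ 2 / 2.
have h2 : cabs (2^-1 : Cplx R) = 1 / 2.
  by rewrite -(rmorph_nat (@toC R)) -fmorphV cabs_toC ger0_norm // div1r.
have h8 : cabs (8^-1 : Cplx R) = 1 / 8.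
  by rewrite -(rmorph_nat (@toC R)) -fmorphV cabs_toC ger0_norm // div1r.
have vz : cabs v <= 9 / 8 * cabs z.
  rewrite (le_trans (cabsD _ _)) // (cabsM (z ^+ 2)) cabsX h2; nra.
have v2 : cabs v <= 1 / 2 by lra.
have H := expC_taylor2 v2; set r := expC v - _ in H.
have -> : (1 - z) * expC v - 1 =
    (1 - z) * r - z ^+ 3 * (2^-1 + z * (3 * 8^-1 + z * 8^-1)).
  by rewrite /r /v; field.
have H1 := cabsB ((1 - z) * r) (z ^+ 3 * (2^-1 + z * (3 * 8^-1 + z * 8^-1))).
have H2 := cabsB 1 z.
have H3 := cabsD (2^-1) (z * (3 * 8^-1 + z * 8^-1)).
have H4 := cabsD (3 * 8^-1) (z * 8^-1).
have h3 : cabs (3 : Cplx R) = 3.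
  by rewrite -(rmorph_nat (@toC R)) cabs_toC ger0_norm.
move: H1 H2 H3 H4.
rewrite (cabsM (1 - z)) (cabsM (z ^+ 3)) (cabsM z) (cabsM z) (cabsM 3).
rewrite !cabsX h2 h8 h3 cabs1 => H1 H2 H3 H4.
have v3 : cabs v ^+ 3 <= (9 / 8 * cabs z) ^+ 3.
  by rewrite lerXn2r ?nnegrE ?cabs_ge0 //; lra.
have z3 : 0 <= cabs z ^+ 3 by rewrite exprn_ge0.
have E1 : cabs (1 - z) * cabs r <= (5 / 4) * (14 * (9 / 8 * cabs z) ^+ 3).
  by rewrite ler_pM ?cabs_ge0 //; lra.
have E2 : cabs (2^-1 + z * (3 * 8^-1 + z * 8^-1)) <= 1 by nra.
have : cabs z ^+ 3 * cabs (2^-1 + z * (3 * 8^-1 + z * 8^-1)) <=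
  cabs z ^+ 3 * 1 by rewrite ler_wpM2l.
by move: E1; rewrite exprMn; move: (cabs z ^+ 3) z3 H1 => *; lra.
Qed.

End ExponentialFactors.

(** * Real-rooted polynomials and operators in D *)

Definition root_prod (R : realType) (rs : seq R) : {poly Cplx R} :=
  \prod_(r <- rs) ('X - (toC r)%:P).

(** This is [root_prod rs] with its coefficients read backwards from index [size rs]; null entries
    of [rs] lower its degree. Its coefficients also give the operator product of the 1 - r D. *)
Definition recip_prod (R : realType) (rs : seq R) : {poly Cplx R} :=
  \prod_(r <- rs) (1 - toC r *: 'X).

Section HyperbolicPolynomials.
Variable R : realType.
Implicit Types (r : R) (rs : seq R) (p q : {poly Cplx R}).

Lemma root_prod_cons r rs :
  root_prod (r :: rs) = ('X - (toC r)%:P) * root_prod rs.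
Proof. exact: big_cons. Qed.

Lemma recip_prod_cons r rs :
  recip_prod (r :: rs) = (1 - toC r *: 'X) * recip_prod rs.
Proof. exact: big_cons. Qed.

Lemma size_root_prod rs : size (root_prod rs) = (size rs).+1.
Proof. by rewrite /root_prod size_prod_XsubC. Qed.

Lemma monic_root_prod rs : root_prod rs \is monic.
Proof. exact: monic_prod_XsubC. Qed.

Lemma hyperbolicP n p :
  hyperbolic n p <-> exists2 rs, size rs = n & p = root_prod rs.
Proof.
split=> [[pm sp rp]|[rs sn ->]].
  have [zs pE] := closed_field_poly_normal p.
  rewrite (monicP pm) scale1r in pE.
  have zr z : z \in zs -> z = toC (complex.Re z).
    move=> zzs; rewrite /toC RRe_real //; apply: rp.
    by rewrite pE root_prod_XsubC.
  exists (map (@complex.Re R) zs).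
    by apply: succn_inj; rewrite -sp pE size_prod_XsubC size_map.
  rewrite pE /root_prod big_map; apply: eq_big_seq => z /zr {1}->.
  by [].
split; first exact: monic_root_prod; first by rewrite size_root_prod sn.
move=> z; rewrite /root_prod -(big_map (@toC R) xpredT (fun c => 'X - c%:P)).
by rewrite root_prod_XsubC => /mapP[r _ ->]; exact: toC_real.
Qed.

Lemma size_recip_prod rs : (size (recip_prod rs) <= (size rs).+1)%N.
Proof.
elim: rs => [|r rs IH]; first by rewrite /recip_prod big_nil size_poly1.
rewrite recip_prod_cons (leq_trans (size_polyMleq _ _)) //=.
have : (size (1 - toC r *: 'X : {poly Cplx R})%R <= 2)%N.
  rewrite (leq_trans (size_polyD _ _)) // geq_max size_poly1 size_polyN /=.
  by rewrite (leq_trans (size_scale_leq _ _)) // size_polyX.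
by move: IH; case: (size _) => [|a]; case: (size _) => [|b] //=; lia.
Qed.

Lemma coef_recip_prod_cons r rs k :
  (recip_prod (r :: rs))`_k =
  (recip_prod rs)`_k - toC r * (if k is k'.+1 then (recip_prod rs)`_k' else 0).
Proof.
rewrite recip_prod_cons mulrBl mul1r coefB -scalerAl coefZ coefXM.
by case: k.
Qed.

Lemma coef_root_prod_rev rs k : (k <= size rs)%N ->
  (root_prod rs)`_(size rs - k) = (recip_prod rs)`_k.
Proof.
elim: rs k => [|r rs IH] k /=.
  by rewrite leqn0 => /eqP ->; rewrite /root_prod /recip_prod !big_nil.
move=> ks; rewrite root_prod_cons mulrBl coefB coefXM coefCM.
rewrite coef_recip_prod_cons.
case: k ks => [|k] ks.
  rewrite !subn0 /= mulr0 -IH // subn0.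
  by rewrite [(root_prod rs)`_(size rs).+1]nth_default ?size_root_prod ?mulr0.
rewrite subSS -(IH k) //.
have [->|ks'] := eqVneq k (size rs).
  rewrite subnn /= [(recip_prod rs)`_(size rs).+1]nth_default //.
  exact: size_recip_prod.
have {ks ks'} ks : (k < size rs)%N by rewrite ltn_neqAle ks' -ltnS.
by rewrite -(IH k.+1) //; move: ks; rewrite -subn_gt0 subnS; case: (_ - _)%N.
Qed.

Lemma coef0_recip_prod rs : (recip_prod rs)`_0 = 1.
Proof.
elim: rs => [|r rs IH]; first by rewrite /recip_prod big_nil coef1.
by rewrite coef_recip_prod_cons mulr0 subr0.
Qed.

Lemma coef1_recip_prod rs : (recip_prod rs)`_1 = - toC (\sum_(r <- rs) r).
Proof.
elim: rs => [|r rs IH].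
  by rewrite /recip_prod !big_nil coef1 rmorph0 oppr0.
rewrite coef_recip_prod_cons coef0_recip_prod IH big_cons rmorphD /=; ring.
Qed.

(** Newton's identity e_1^2 - 2 e_2 = p_2. As the r are real, the first two coefficients thus bound
    all of them. *)
Lemma coef2_recip_prod rs :
  (recip_prod rs)`_1 ^+ 2 - 2 * (recip_prod rs)`_2 =
  toC (\sum_(r <- rs) r ^+ 2).
Proof.
elim: rs => [|r rs IH].
  by rewrite /recip_prod !big_nil !coef1 rmorph0 expr0n mulr0 subr0.
rewrite !coef_recip_prod_cons coef0_recip_prod big_cons rmorphD rmorphXn /=.
rewrite -IH; ring.
Qed.

Lemma horner_recip_prod rs z :
  (recip_prod rs).[z] = \prod_(r <- rs) (1 - toC r * z).
Proof.
rewrite /recip_prod horner_prod; apply: eq_bigr => r _.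
by rewrite hornerD hornerN hornerZ hornerX hornerC.
Qed.

Lemma coef0_root_prod rs : (root_prod rs)`_0 = \prod_(r <- rs) - toC r.
Proof.
rewrite -horner_coef0 /root_prod horner_prod.
by apply: eq_bigr => r _; rewrite hornerXsubC sub0r.
Qed.

Lemma recip_prod_real rs k : (recip_prod rs)`_k \is Num.real.
Proof.
elim: rs k => [|r rs IH] k.
  by rewrite /recip_prod big_nil coef1 realn.
by rewrite coef_recip_prod_cons; case: k => [|k];
  rewrite ?mulr0 ?subr0 ?realB ?realM ?toC_real.
Qed.

End HyperbolicPolynomials.

(** * Power series in D acting on polynomials *)

Section DifferentialOperators.
Variable R : realType.
Implicit Types (c d : nat -> Cplx R) (p q : {poly Cplx R}).

Lemma series_in_D_widen c p N : (size p <= N)%N ->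
  series_in_D c p = \sum_(k < N) c k *: p^`(k).
Proof.
move=> pN; rewrite /series_in_D (big_ord_widen _ (fun k => c k *: p^`(k)) pN).
rewrite big_mkcond /=; apply: eq_bigr => k _; case: ltnP => // pk.
by rewrite derivn_poly0 // scaler0.
Qed.

Lemma series_in_D_is_linear c : linear (series_in_D c).
Proof.
move=> a p q; pose N := maxn (size p) (size q).
have pN : (size p <= N)%N by exact: leq_maxl.
have qN : (size q <= N)%N by exact: leq_maxr.
have pqN : (size (a *: p + q)%R <= N)%N.
  rewrite (leq_trans (size_polyD _ _)) // geq_max qN andbT.
  exact: leq_trans (size_scale_leq _ _) pN.
rewrite !(series_in_D_widen _ (N := N)) // scaler_sumr -big_split /=.
apply: eq_bigr => k _; rewrite linearP scalerDr !scalerA.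
by rewrite [a * _]mulrC.
Qed.

HB.instance Definition _ c := GRing.isLinear.Build (Cplx R)
  {poly Cplx R} {poly Cplx R} *:%R (series_in_D c) (series_in_D_is_linear c).

Lemma size_derivn_leq p k : (size p^`(k) <= size p)%N.
Proof.
elim: k => [|k IH] //; rewrite derivnS (leq_trans _ IH) //.
have [->|/lt_size_deriv/ltnW//] := eqVneq p^`(k) 0.
by rewrite linear0.
Qed.

Lemma size_series_in_D c p : (size (series_in_D c p) <= size p)%N.
Proof.
rewrite (leq_trans (size_sum _ _ _)) //; apply/bigmax_leqP => k _.
exact: leq_trans (size_scale_leq _ _) (size_derivn_leq _ _).
Qed.

Lemma series_in_D_comm c d p :
  series_in_D c (series_in_D d p) = series_in_D d (series_in_D c p).
Proof.
rewrite !(series_in_D_widen _ (N := size p)) ?size_series_in_D //.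
have E e f : \sum_(k < size p) e k *: (series_in_D f p)^`(k) =
    \sum_(k < size p) \sum_(j < size p) (e k * f j) *: p^`(k + j).
  apply: eq_bigr => k _; rewrite /series_in_D linear_sum scaler_sumr /=.
  by apply: eq_bigr => j _; rewrite derivnZ scalerA /derivn -iterD.
rewrite -/(series_in_D d p) -/(series_in_D c p) !E exchange_big /=.
apply: eq_bigr => k _; apply: eq_bigr => j _.
by rewrite mulrC addnC.
Qed.

Lemma coef_series_in_D_Xn c n k : (k <= n)%N ->
  (series_in_D c 'X^n)`_(n - k) = c k * (n ^_ k)%:R.
Proof.
move=> kn; rewrite (series_in_D_widen _ (N := n.+1)) ?size_polyXn //.
rewrite coef_sum (bigD1 (inord k)) //= inordK // big1 ?addr0.
  by rewrite coefZ derivnXn coefMn coefXn eqxx.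
move=> j jk; rewrite coefZ derivnXn coefMn coefXn.
have jn : (j <= n)%N by rewrite -ltnS.
case: eqVneq => [E|]; last by rewrite mul0rn mulr0.
case/negP: jk; apply/eqP/val_inj; rewrite /= inordK //.
by move: E; lia.
Qed.

Lemma comp_XaddC_derivn p (a : Cplx R) k :
  (p \Po ('X + a%:P))^`(k) = p^`(k) \Po ('X + a%:P).
Proof.
elim: k => [|k IH] //; rewrite !derivnS IH deriv_comp.
by rewrite derivD derivX derivC addr0 mulr1.
Qed.

Lemma series_in_D_comp c p (a : Cplx R) :
  series_in_D c (p \Po ('X + a%:P)) = series_in_D c p \Po ('X + a%:P).
Proof.
rewrite /series_in_D size_comp_poly2 ?size_XaddC // linear_sum /=.
by apply: eq_bigr => k _; rewrite linearZ /= comp_XaddC_derivn.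
Qed.

Lemma series_in_D_monic c p n : c 0 = 1 -> p \is monic -> size p = n.+1 ->
  series_in_D c p \is monic /\ size (series_in_D c p) = n.+1.
Proof.
move=> c0 pm sp; rewrite /series_in_D sp big_ord_recl c0 scale1r derivn0.
set q := \sum_(i < n) _.
have sq : (size q < size p)%N.
  rewrite sp ltnS (leq_trans (size_sum _ _ _)) //; apply/bigmax_leqP => k _.
  rewrite (leq_trans (size_scale_leq _ _)) // derivSn.
  rewrite (leq_trans (size_derivn_leq _ _)) //.
  have := @lt_size_deriv _ p; rewrite sp ltnS; apply.
  exact: monic_neq0.
by rewrite size_polyDl // monicE lead_coefDl // sp; split.
Qed.

Lemma series_in_D_recip_cons (r : R) rs p :
  series_in_D (fun k => (recip_prod (r :: rs))`_k) p =
  series_in_D (fun k => (recip_prod rs)`_k) p -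
  toC r *: (series_in_D (fun k => (recip_prod rs)`_k) p)^`().
Proof.
(* The extra term, zero because the derivative of order [size p] vanishes, leaves room for the index
   shift due to the factor 'X. *)
rewrite !(series_in_D_widen _ (N := (size p).+1)) //.
under eq_bigr do rewrite coef_recip_prod_cons scalerBl.
rewrite sumrB; congr (_ - _).
rewrite big_ord_recl mulr0 scale0r add0r.
rewrite big_ord_recr /= derivn_poly0 // scaler0 addr0.
rewrite linear_sum scaler_sumr; apply: eq_bigr => k _ /=.
by rewrite linearZ /= scalerA.
Qed.

End DifferentialOperators.

(** The condition bears on the coefficients alone: it makes sense before [c] is known to expand an
    entire function, and it passes to coefficientwise limits. *)
Definition preserves_hyperbolicity (R : realType) (c : nat -> Cplx R) : Prop :=
  forall n p, hyperbolic n p -> hyperbolic n (series_in_D c p).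

(** * Preservation of real-rootedness and coefficient bounds *)

Section Preservation.
Variable R : realType.
Implicit Types (r : R) (rs : seq R) (p q : {poly Cplx R}) (c : nat -> Cplx R).

(** The logarithmic derivative; at a nonreal z no factor vanishes. *)
Lemma deriv_root_prod rs (z : Cplx R) : z \isn't Num.real ->
  (root_prod rs)^`().[z] =
  (root_prod rs).[z] * \sum_(r <- rs) (z - toC r)^-1.
Proof.
move=> zr; elim: rs => [|r rs IH].
  by rewrite /root_prod !big_nil derivC hornerC mulr0.
have nz : z - toC r != 0.
  by apply: contra zr; rewrite subr_eq0 => /eqP ->; exact: toC_real.
rewrite root_prod_cons derivM derivXsubC mul1r hornerD !hornerM IH big_cons.
by rewrite hornerXsubC mulrDr mulrAC mulfV // mul1r mulrA.
Qed.

(* A nonreal root z would satisfy 1 = r * \sum 1 / (z - r_i), hence be fixed by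
   conjugation, as Im (1 / (z - r_i)) has the sign of - Im z for all i. *)
Lemma sub_deriv_root_real r rs (z : Cplx R) :
  root (root_prod rs - toC r *: (root_prod rs)^`()) z -> z \is Num.real.
Proof.
move=> rz; apply/negPn/negP => zr.
have nz s : z - toC s != 0.
  by apply: contra zr; rewrite subr_eq0 => /eqP ->; exact: toC_real.
have pz : (root_prod rs).[z] != 0.
  rewrite /root_prod horner_prod prodf_seq_neq0; apply/allP => s _ /=.
  by rewrite hornerXsubC.
move: rz; rewrite rootE hornerD hornerN hornerZ deriv_root_prod //.
rewrite mulrCA -[X in X - _]mulr1 -mulrBr mulf_eq0 (negPf pz) /= subr_eq0.
set S := \sum_(s <- rs) _ => /eqP rS.
have r0 : toC r != 0.
  by apply/eqP => r0; move: rS; rewrite r0 mul0r => /eqP; rewrite oner_eq0.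
have Sc : S^* = S.
  have : (toC r * S)^* = 1 by rewrite -rS rmorph1.
  by rewrite rmorphM /= (@conj_Creal _ (toC r)) ?toC_real // rS => /(mulfI r0).
have SE : S - S^* = (z^* - z) * \sum_(s <- rs) (`|z - toC s| ^+ 2)^-1.
  rewrite /S rmorph_sum mulr_sumr -sumrB; apply: eq_bigr => s _ /=.
  have cE : (z - toC s)^* = z^* - toC s.
    by rewrite rmorphB /= (@conj_Creal _ (toC s)) ?toC_real.
  rewrite normCK fmorphV /= cE.
  have nzc : z^* - toC s != 0 by rewrite -cE fmorph_eq0.
  by field; rewrite nz nzc.
move: SE; rewrite Sc subrr => /esym/eqP; rewrite mulf_eq0 subr_eq0.
case/orP => [/eqP/CrealP zr'|]; first by rewrite zr' in zr.
rewrite psumr_eq0 => [/allP H|s _]; last by rewrite invr_ge0 exprn_ge0.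
(* A vanishing sum of the positive numbers 1 / |z - s|^2 leaves no s in [rs], so S = 0, against 1 =
   r * S. *)
move: rS; rewrite /S big_seq big1 ?mulr0 => [/eqP|s srs].
  by rewrite oner_eq0.
move: (H s srs); rewrite /= invr_eq0 expf_eq0 /= normr_eq0.
by rewrite (negPf (nz s)).
Qed.

Lemma preserves_hyperbolicity_recip_prod rs :
  preserves_hyperbolicity (fun k => (recip_prod rs)`_k).
Proof.
move=> n p hp.
have [pm sp _] := hp.
elim: rs => [|r rs IH].
  rewrite /series_in_D sp big_ord_recl /recip_prod big_nil coef1 scale1r.
  rewrite big1 ?addr0 ?derivn0 // => k _.
  by rewrite coef1 scale0r.
have [c1 c2] := @series_in_D_monic R (fun k => (recip_prod (r :: rs))`_k) p n
  (coef0_recip_prod _) pm sp.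
split=> // z; rewrite series_in_D_recip_cons.
by have [ss _ ->] := (hyperbolicP _ _).1 IH; exact: sub_deriv_root_real.
Qed.

Lemma preserves_hyperbolicity_coef0 c : preserves_hyperbolicity c -> c 0 = 1.
Proof.
move=> hc; have h1 : hyperbolic 0 (1 : {poly Cplx R}).
  by apply/hyperbolicP; exists [::] => //; rewrite /root_prod big_nil.
have [m _ _] := hc _ _ h1; move: m.
rewrite /series_in_D size_poly1 big_ord_recl big_ord0 addr0 derivn0.
by rewrite monicE alg_polyC lead_coefC => /eqP.
Qed.

Lemma cabs_root_prod_ge rs (z : Cplx R) :
  `|complex.Im z| ^+ size rs <= cabs (root_prod rs).[z].
Proof.
rewrite /root_prod horner_prod; elim: rs => [|r rs IH].
  by rewrite big_nil cabs1.
rewrite big_cons cabsM exprS ler_pM ?exprn_ge0 // hornerXsubC.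
have -> : complex.Im z = complex.Im (z - toC r).
  by case: z {IH} => a b; rewrite /= oppr0 addr0.
exact: Im_le_cabs.
Qed.

(* A polynomial with n real roots is at least `|Im z| ^+ n in modulus at z, and
   this bound survives in the limit. *)
Lemma preserves_hyperbolicity_lim (T : Type) (F : set_system T)
    {FF : ProperFilter F} (cs : T -> nat -> Cplx R) c :
  (forall t, preserves_hyperbolicity (cs t)) ->
  (forall k, cs t k @[t --> F] --> c k) -> preserves_hyperbolicity c.
Proof.
move=> hcs csc n p hp.
have c0 : c 0 = 1.
  apply: (cvgC_unique (csc 0)).
  under eq_fun do rewrite (preserves_hyperbolicity_coef0 (hcs _)).
  exact: cvg_cst.
have [pm sp _] := hp.
have [m1 s1] := series_in_D_monic c0 pm sp.
split=> // z /eqP rz.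
have H : (series_in_D (cs t) p).[z] @[t --> F] --> (series_in_D c p).[z].
  have E e : (series_in_D e p).[z] =
      series (fun k => e k * p^`(k).[z]) (size p).
    rewrite /series_in_D horner_sum /series /= big_mkord.
    by apply: eq_bigr => k _; rewrite hornerZ.
  rewrite E; under eq_fun do rewrite E.
  apply: cvg_series_param => k; apply: cvgCM; last exact: cvg_cst.
  exact: csc.
move/cvg_cabs: H; rewrite rz cabs0 => H.
have : `|complex.Im z| ^+ n <= 0.
  apply: (cvgr_to_ge H); apply: nearW => t.
  have [rs rsn ->] := (hyperbolicP _ _).1 (hcs t _ _ hp).
  by rewrite -rsn; exact: cabs_root_prod_ge.
rewrite le_eqVlt ltNge exprn_ge0 // orbF expf_eq0 normr_eq0 => /andP[_].
by case: z {rz H} => a b /=; rewrite complex_real.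
Qed.

(** All information on [c] is drawn from here: up to falling factorials, its terms up to index n are
    signed elementary symmetric functions of n real numbers, and n is free. *)
Lemma preserved_Xn c n : preserves_hyperbolicity c ->
  exists rs, [/\ size rs = n, series_in_D c 'X^n = root_prod rs &
    forall k, (recip_prod rs)`_k = c k * (n ^_ k)%:R].
Proof.
move=> hc.
have hX : hyperbolic n ('X^n : {poly Cplx R}).
  apply/hyperbolicP; exists (nseq n 0); first by rewrite size_nseq.
  by rewrite /root_prod big_nseq rmorph0 subr0 iter_mulr_1.
have [rs rsn E] := (hyperbolicP _ _).1 (hc _ _ hX).
exists rs; split=> // k; have [kn|nk] := leqP k n.
  by rewrite -coef_root_prod_rev ?rsn // -E coef_series_in_D_Xn.
rewrite ffact_small // mulr0 nth_default //.
by rewrite (leq_trans (size_recip_prod _)) // rsn.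
Qed.

Lemma preserves_hyperbolicity_real c k : preserves_hyperbolicity c ->
  c k \is Num.real.
Proof.
move=> hc; have [rs [_ _ H]] := preserved_Xn k hc.
have f0 : (k`!%:R : Cplx R) != 0 by rewrite pnatr_eq0 -lt0n fact_gt0.
have -> : c k = (recip_prod rs)`_k / k`!%:R.
  by rewrite H ffactnn mulfK.
by rewrite realM ?recip_prod_real // realV realn.
Qed.

(** Once the roots are divided by n, their sum is the constant - c 1 and the sum of their squares
    tends to c 1 ^+ 2 - 2 * c 2. *)
Lemma sum_sqr_roots c rs n : size rs = n ->
  (forall k, (recip_prod rs)`_k = c k * (n ^_ k)%:R) ->
  toC (\sum_(r <- rs) r) = - (c 1 * n%:R) /\
  toC (\sum_(r <- rs) r ^+ 2) =
    n%:R * (c 1 ^+ 2 + (n.-1)%:R * (c 1 ^+ 2 - 2 * c 2)).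
Proof.
move=> rsn H; split.
  by rewrite -[LHS]opprK -coef1_recip_prod H ffactn1.
rewrite -coef2_recip_prod !H ffactn1 ffactnSr ffactn1 natrM.
case: n {rsn H} => [|n]; first by ring.
by rewrite subn1 /= -(natr1 n); ring.
Qed.

Lemma AGM_seq (s : seq R) : (forall x, x \in s -> 0 <= x) ->
  \prod_(x <- s) x <= ((\sum_(x <- s) x) / (size s)%:R) ^+ size s.
Proof.
move=> s0.
have := @leif_AGM R 'I_(size s) xpredT (fun i => nth 0 s i).
rewrite cardT size_enum_ord => H.
rewrite [X in X <= _](big_nth 0) [X in X / _](big_nth 0) !big_mkord.
by apply: H => i _; rewrite s0 // mem_nth.
Qed.

(* AM-GM applied to the squares of the roots of the image of 'X^n, whose
   product is (c n * n`!) ^+ 2. *)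
Lemma preserves_hyperbolicity_bound c (M : R) n : preserves_hyperbolicity c ->
  c 1 ^+ 2 <= toC M -> c 1 ^+ 2 - 2 * c 2 <= toC M ->
  (cabs (c n) * n`!%:R) ^+ 2 <= (n%:R * M) ^+ n.
Proof.
move=> hc M1 M2; have [rs [rsn E H]] := preserved_Xn n hc.
have [_ S2] := sum_sqr_roots rsn H.
have -> : cabs (c n) * n`!%:R = \prod_(r <- rs) `|r|.
  have -> : (n`!%:R : R) = cabs (n`!%:R : Cplx R).
    by rewrite -(rmorph_nat (@toC R)) cabs_toC normr_nat.
  rewrite -cabsM -ffactnn -H -coef_root_prod_rev ?rsn // subnn.
  rewrite coef0_root_prod cabs_prod; apply: eq_bigr => r _.
  by rewrite cabsN cabs_toC.
have := @AGM_seq [seq r ^+ 2 | r <- rs].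
rewrite !big_map size_map rsn => AG.
have -> : (\prod_(r <- rs) `|r|) ^+ 2 = \prod_(r <- rs) r ^+ 2.
  rewrite -prodrXl; apply: eq_bigr => r _; exact: real_normK (num_real _).
apply: (le_trans (AG _)) => [x /mapP[r _ ->]|]; first exact: sqr_ge0.
have [->|n0] := posnP n; first by rewrite !expr0.
have n0' : (n%:R : R) != 0 by rewrite pnatr_eq0 -lt0n.
have s0 : 0 <= \sum_(r <- rs) r ^+ 2 by apply: sumr_ge0 => r _; exact: sqr_ge0.
have le1 : (\sum_(r <- rs) r ^+ 2) / n%:R <= n%:R * M.
  rewrite -le_toC rmorphM /= fmorphV S2 !rmorph_nat.
  have n0c : (n%:R : Cplx R) != 0 by rewrite pnatr_eq0 -lt0n.
  rewrite mulrAC mulfV // mul1r rmorphM /= rmorph_nat.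
  have -> : (n%:R : Cplx R) * toC M = toC M + (n.-1)%:R * toC M.
    by rewrite -{1}(prednK n0) -natr1 mulrDl mul1r addrC.
  by rewrite lerD // ler_wpM2l // ler0n.
rewrite lerXn2r ?nnegrE ?divr_ge0 ?ler0n //.
by rewrite (le_trans _ le1) ?divr_ge0 ?ler0n.
Qed.

Lemma exp_term_le (x : R) k : 0 <= x -> x ^+ k / k`!%:R <= expR x.
Proof.
move=> x0; have t0 j : 0 <= exp_coeff x j.
  by rewrite /exp_coeff /= divr_ge0 ?exprn_ge0 ?ler0n.
have := series_le_limn k.+1 t0 (is_cvg_series_exp_coeff x).
rewrite -/(expR x) seriesSr; apply: le_trans.
by rewrite lerDr /series /= sumr_ge0.
Qed.

(** The majorant depends on [M] and [rho] only, so it dominates whole families. With k^k <= e^k k!,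
    the AM-GM bound gives |c k|^2 rho^(2k) <= (e |M| rho^2)^k / k! = (A^k / k!) 4^(-k) <= exp A *
    4^(-k), where A = 4 e |M| rho^2. The factor 4 in A thus makes the majorant geometric of ratio 1
    / 2; taking square roots, exp A is kept since it is at least 1. *)
Lemma coef_majorant (M rho : R) : 0 <= rho ->
  exists2 g : nat -> R, cvgn (series g) &
  forall c k, preserves_hyperbolicity c ->
    c 1 ^+ 2 <= toC M -> c 1 ^+ 2 - 2 * c 2 <= toC M ->
    cabs (c k) * rho ^+ k <= g k.
Proof.
move=> rho0.
pose A := 4 * expR 1 * `|M| * rho ^+ 2.
have A0 : 0 <= A by rewrite /A !mulr_ge0 ?expR_ge0 ?exprn_ge0 ?normr_ge0.
exists (geometric (expR A) (1 / 2)).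
  by apply: is_cvg_geometric_series; rewrite ger0_norm; lra.
move=> c k hc M1 M2; rewrite /geometric /=.
have B := preserves_hyperbolicity_bound k hc M1 M2.
have f0 : 0 < (k`!%:R : R) by rewrite ltr0n fact_gt0.
have e1 : 1 <= expR A by rewrite -expR0 ler_expR.
rewrite -(@ler_pXn2r _ 2) ?nnegrE ?mulr_ge0 ?cabs_ge0 ?exprn_ge0 ?expR_ge0 //.
apply: (@le_trans _ _ (expR A * ((1 / 2) ^+ k) ^+ 2)); last first.
  rewrite [leRHS]exprMn ler_wpM2r ?exprn_ge0 // expr2; nra.
have h := exp_term_le k A0.
apply: (@le_trans _ _ (A ^+ k / k`!%:R * ((1 / 2) ^+ k) ^+ 2)); last first.
  by rewrite ler_wpM2r ?exprn_ge0.
have kk : k%:R ^+ k / k`!%:R <= expR 1 ^+ k :> R.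
  by rewrite -expRM_natl mulr1; exact: exp_term_le.
have -> : A ^+ k / k`!%:R * ((1 / 2) ^+ k) ^+ 2 =
    (expR 1 ^+ k * (`|M| ^+ k) / k`!%:R) * (rho ^+ k) ^+ 2.
  have A4 : A * (1 / 2) ^+ 2 = expR 1 * `|M| * rho ^+ 2 by rewrite /A; field.
  rewrite -[((1 / 2) ^+ k) ^+ 2]exprM mulnC exprM mulrAC -exprMn A4.
  by rewrite -[(rho ^+ k) ^+ 2]exprM mulnC exprM 2!exprMn mulrAC.
rewrite exprMn ler_wpM2r ?exprn_ge0 //.
rewrite -(@ler_pM2r _ (k`!%:R ^+ 2)) ?exprn_gt0 // -exprMn.
apply: (le_trans B).
have -> : expR 1 ^+ k * `|M| ^+ k / k`!%:R * k`!%:R ^+ 2 =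
   (expR 1 ^+ k * k`!%:R) * `|M| ^+ k :> R by field; rewrite lt0r_neq0.
have le2 : (k%:R * M) ^+ k <= k%:R ^+ k * `|M| ^+ k.
  rewrite (le_trans (ler_norm _)) // normrX normrM exprMn.
  by rewrite normr_nat.
apply: (le_trans le2); rewrite ler_wpM2r ?exprn_ge0 //.
by rewrite -ler_pdivrMr.
Qed.

End Preservation.

(** * Preservers commute with translations *)

Section PreserversAreFunctionsOfD.
Variable R : realType.
Implicit Types (r t : R) (rs : seq R) (p q E G : {poly Cplx R}).

Lemma coef_comp_XaddC p (a : Cplx R) j :
  (p \Po ('X + a%:P))`_j *+ j`! = p^`(j).[a].
Proof.
have -> : p^`(j).[a] = (p^`(j) \Po ('X + a%:P)).[0].
  by rewrite horner_comp hornerD hornerX hornerC add0r.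
by rewrite -comp_XaddC_derivn horner_coef0 coef_derivn addn0 ffactnn.
Qed.

Lemma coef_comp_XaddC_lead p (a : Cplx R) d : (size p <= d.+1)%N ->
  (p \Po ('X + a%:P))`_d = p`_d.
Proof.
move=> sp; have := coef_comp_XaddC p a d.
have -> : p^`(d) = (p`_d *+ d`!)%:P.
  apply/polyP => i; rewrite coef_derivn coefC; case: i => [|i] /=.
    by rewrite addn0 ffactnn.
  by rewrite nth_default ?mul0rn // (leq_trans sp) //; lia.
by rewrite hornerC; apply: (pmulrnI (fact_gt0 d)).
Qed.

Lemma coef_comp_XaddC_sublead p (a : Cplx R) d : (size p <= d.+2)%N ->
  (p \Po ('X + a%:P))`_d = p`_d + a * (p`_d.+1 *+ d.+1).
Proof.
move=> sp; have := coef_comp_XaddC p a d.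
have -> : p^`(d) = (p`_d *+ d`!)%:P + (p`_d.+1 *+ d.+1`!) *: 'X.
  apply/polyP => i; rewrite coef_derivn coefD coefC coefZ coefX.
  case: i => [|[|i]] /=.
  - by rewrite addn0 ffactnn mulr0 addr0.
  - by rewrite addn1 add0r mulr1 -[d.+1`!]ffactnn ffactnSr subSnn muln1.
  - by rewrite nth_default ?mul0rn ?mulr0 ?addr0 // (leq_trans sp) //; lia.
rewrite hornerD hornerC hornerZ hornerX => E.
apply: (pmulrnI (fact_gt0 d)) => /=.
by rewrite E mulrnDl -mulrnAr -mulrnA -factS mulrC.
Qed.

Lemma linear_bounded (B C : Cplx R) (K : R) :
  (forall t : R, cabs (B + toC t * C) <= K) -> C = 0.
Proof.
move=> H; apply/eqP; rewrite -cabs_eq0; apply/eqP.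
have H0 : cabs B <= K by have := H 0; rewrite rmorph0 mul0r addr0.
have c0 := cabs_ge0 C; apply/eqP; rewrite eq_le c0 andbT leNgt.
apply/negP => c1.
pose t := (2 * K + 1) / cabs C.
have := cabsB (B + toC t * C) B.
have -> : B + toC t * C - B = toC t * C by ring.
rewrite cabsM cabs_toC.
have k0 : 0 <= K by exact: le_trans (cabs_ge0 _) H0.
have t0 : 0 <= t by rewrite divr_ge0 //; lra.
rewrite ger0_norm // /t divfK ?gt_eqF //.
by have := H t; rewrite /t; lra.
Qed.

(** The coefficients are dominated by those of (1 + rho x)^n, with n the size of [rs], and the
    latter add up to (1 + rho)^n. *)
Lemma coef_recip_prod_le rs k (rho : R) : 0 <= rho ->
  (forall r, r \in rs -> `|r| <= rho) ->
  cabs (recip_prod rs)`_k <= (1 + rho) ^+ size rs.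
Proof.
move=> rho0; elim: rs k => [|r rs IH] k rr.
  by rewrite /recip_prod big_nil coef1; case: (k == 0)%N; rewrite ?cabs1 ?cabs0.
rewrite coef_recip_prod_cons (le_trans (cabsB _ _)) // exprS mulrDl mul1r.
have {}IH j : cabs (recip_prod rs)`_j <= (1 + rho) ^+ size rs.
  by apply: IH => s srs; apply: rr; rewrite inE srs orbT.
rewrite lerD // cabsM cabs_toC ler_pM ?cabs_ge0 //.
  by apply: rr; rewrite mem_head.
by case: k => [|k]; rewrite ?cabs0 ?exprn_ge0 // addr_ge0.
Qed.


Lemma root_prod_comp rs t :
  root_prod rs \Po ('X + (toC t)%:P) = root_prod [seq r - t | r <- rs].
Proof.
rewrite /root_prod big_map (big_morph _ (fun p q => comp_polyM p q _)
  (comp_polyC 1 _)).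
apply: eq_bigr => r _; rewrite comp_polyB comp_polyX comp_polyC.
by rewrite rmorphB /= polyCB; ring.
Qed.

Lemma hyperbolic_comp n p t : hyperbolic n p ->
  hyperbolic n (p \Po ('X + (toC t)%:P)).
Proof.
move=> /hyperbolicP[rs rsn ->]; apply/hyperbolicP.
by exists [seq r - t | r <- rs]; rewrite ?size_map ?root_prod_comp.
Qed.

(* Otherwise the coefficient just below the leading one of the translate of E
   is affine and nonconstant in t, while fixed sums of the roots and of their
   squares (or the sign of the latter) bound it. *)
Lemma hyperbolic_translates_const n G E : G \is monic -> size G = n.+1 ->
  (size E <= n)%N ->
  (forall t, hyperbolic n (G + (E \Po ('X + (toC t)%:P)))) ->
  (size E <= 1)%N.
Proof.
move=> mG sG sE H; rewrite leqNgt; apply/negP.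
case sE' : (size E) sE => [|[|d]] // sE _.
have dn : (d < n)%N by lia.
have eE : E`_d.+1 *+ d.+1 != 0.
  rewrite mulrn_eq0 /= -[d.+1]/(d.+2.-1) -sE' -lead_coefE lead_coef_eq0.
  by rewrite -size_poly_eq0 sE'.
pose F t := G + (E \Po ('X + (toC t)%:P)).
have Fd t : (F t)`_d = (G`_d + E`_d) + toC t * (E`_d.+1 *+ d.+1).
  by rewrite coefD coef_comp_XaddC_sublead ?sE' // addrA.
have Fhi t j : (d < j)%N -> (F t)`_j = (F 0)`_j.
  move=> dj; rewrite !coefD; congr (_ + _).
  by rewrite !coef_comp_XaddC_lead ?sE' // ltnS.
suff [K HK] : exists K : R, forall t, cabs (F t)`_d <= K.
  move/eqP: eE; apply; apply: (@linear_bounded (G`_d + E`_d) _ K) => t.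
  by rewrite -Fd.
have rep t : exists2 rs, size rs = n &
    forall k, (k <= n)%N -> (F t)`_(n - k) = (recip_prod rs)`_k.
  have [rs rsn Ft] := (hyperbolicP _ _).1 (H t).
  by exists rs => // k kn; rewrite /F Ft -rsn coef_root_prod_rev // rsn.
clearbody F.
have n2 : (2 <= n)%N by lia.
have sq t rs : size rs = n ->
    (forall k, (k <= n)%N -> (F t)`_(n - k) = (recip_prod rs)`_k) ->
    toC (\sum_(r <- rs) r ^+ 2) = (F 0)`_(n - 1) ^+ 2 - 2 * (F t)`_(n - 2).
  move=> rsn E1; rewrite -coef2_recip_prod -(E1 1) ?(ltnW n2) // -(E1 2) //.
  by rewrite (Fhi t) //; lia.
(* If n = d + 2, the varying coefficient itself enters the sum of squares X t, which is affine in t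
   and nonnegative, so that X t + X (- t) = 2 * X 0 bounds it. *)
have [dn2|dn2] := leqP n d.+2.
  have nd : (n - 2)%N = d by lia.
  pose X t := (F 0)`_(n - 1) ^+ 2 - 2 * (F t)`_d.
  have X0 t : 0 <= X t.
    have [rs rsn E1] := rep t; rewrite /X -nd -(sq t rs rsn E1).
    rewrite -(rmorph0 (@toC R)) le_toC.
    by apply: sumr_ge0 => r _; exact: sqr_ge0.
  have XX t : X t + X (- t) = 2 * X 0.
    rewrite /X (Fd t) (Fd (- t)) (Fd 0) rmorph0 rmorphN.
    move: (G`_d + E`_d) (E`_d.+1 *+ _) ((F 0)`_(n - 1) ^+ 2) => x y w.
    by ring.
  exists (cabs (2 * X 0) + cabs ((F 0)`_(n - 1) ^+ 2)) => t.
  have Xt : cabs (X t) <= cabs (2 * X 0).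
    rewrite -le_toC !cabsE -(XX t) (ger0_norm (X0 t)) ger0_norm ?lerDl //.
    by apply: addr_ge0; apply: X0.
  have c2 : cabs (2 * (F t)`_d) = 2 * cabs (F t)`_d.
    by rewrite cabsM -(rmorph_nat (@toC R)) cabs_toC ger0_norm.
  have := cabsB ((F 0)`_(n - 1) ^+ 2) (X t).
  have -> : (F 0)`_(n - 1) ^+ 2 - X t = 2 * (F t)`_d by rewrite /X; ring.
  rewrite c2; have := cabs_ge0 (F t)`_d; lra.
(* Now d < n - 2, so the two coefficients that determine the sum of squares do not vary with t; r^2
   <= V then gives |r| <= 1 + V. *)
pose V := complex.Re ((F 0)`_(n - 1) ^+ 2 - 2 * (F 0)`_(n - 2)).
exists ((1 + (1 + V)) ^+ n) => t.
have [rs rsn E1] := rep t.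
have VE : \sum_(r <- rs) r ^+ 2 = V.
  by rewrite /V -(Fhi t (n - 2)%N) -?(sq t rs) //; lia.
have -> : d = (n - (n - d))%N by lia.
rewrite E1 ?leq_subr // -rsn.
have V0 : 0 <= V by rewrite -VE; apply: sumr_ge0 => r _; exact: sqr_ge0.
apply: coef_recip_prod_le => [|r rrs]; first by lra.
have : `|r| ^+ 2 <= V.
  rewrite -VE real_normK ?num_real // (big_rem r) //= lerDl.
  by apply: sumr_ge0 => s _; exact: sqr_ge0.
by have := normr_ge0 r; nra.
Qed.

Lemma poly_linear_ext (S T : {linear {poly Cplx R} -> {poly Cplx R}}) n :
  (forall k, (k < n)%N -> S 'X^k = T 'X^k) ->
  forall p, (size p <= n)%N -> S p = T p.
Proof.
move=> ST p pn; rewrite -(coefK p) poly_def !linear_sum; apply: eq_bigr => k _.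
by rewrite !linearZ /= ST // (leq_trans _ pn).
Qed.

(** The constant terms of the T x^k force the choice of [c]. By strong induction T agrees with
    phi(D) below degree n, and E = T x^n - phi(D) x^n has degree below n. As (x - t)^n - x^n has
    lower degree too and phi(D) commutes with translations, T ((x - t)^n) translated back is phi(D)
    x^n + E(x + t). Real-rootedness for all t makes E constant, and E(0) = 0 by the choice of
    [c]. *)
Lemma preserver_series_in_D (T : {linear {poly Cplx R} -> {poly Cplx R}}) :
  @monic_preservers R T ->
  exists c : nat -> Cplx R, preserves_hyperbolicity c /\ T =1 series_in_D c.
Proof.
move=> HT; have hT n p : hyperbolic n p -> hyperbolic n (T p).
  by move=> hp; have [_ ] := HT n I; apply; exists p.
pose c k := (T 'X^k)`_0 / k`!%:R.
have cE k : (T 'X^k)`_0 = c k * k`!%:R.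
  by rewrite /c divfK // pnatr_eq0 -lt0n fact_gt0.
have hXn n t : hyperbolic n (('X + (toC t)%:P) ^+ n).
  apply/hyperbolicP; exists (nseq n (- t)); first by rewrite size_nseq.
  by rewrite /root_prod big_nseq iter_mulr_1 rmorphN polyCN opprK.
have hX n : hyperbolic n ('X^n : {poly Cplx R}).
  by have := hXn n 0; rewrite rmorph0 addr0.
have c0 : c 0 = 1.
  have [] := hT 0 _ (hX 0); rewrite /c fact0 divr1 => m s _.
  by have := monicP m; rewrite lead_coefE s.
suff TX n : T 'X^n = series_in_D c 'X^n.
  have TE : T =1 series_in_D c.
    by move=> p; exact: (poly_linear_ext (n := size p) (fun k _ => TX k)).
  by exists c; split=> // n p hp; rewrite -TE; exact: hT.
elim/ltn_ind: n => n IH.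
have Tlow p : (size p <= n)%N -> T p = series_in_D c p.
  exact: (poly_linear_ext (S := T) (T := series_in_D c)).
have [m1 s1 _] := hT n _ (hX n).
have [m2 s2] := series_in_D_monic c0 (monicXn _ n) (size_polyXn _ n).
set G := series_in_D c 'X^n in m2 s2 *; pose E := T 'X^n - G.
have sE : (size E <= n)%N.
  apply/leq_sizeP => j; rewrite leq_eqVlt => /orP[/eqP <-|nj].
    move/monicP: m1; move/monicP: m2; rewrite !lead_coefE s1 s2 /= => e1 e2.
    by rewrite coefB e1 e2 subrr.
  by rewrite coefB !nth_default ?subrr ?s1 ?s2.
have transl t : hyperbolic n (G + (E \Po ('X + (toC t)%:P))).
  have := hyperbolic_comp t (hT n _ (hXn n (- t))).
  set q := ('X + _) ^+ n.
  have qE : q = 'X^n \Po ('X + (toC (- t))%:P) by rewrite comp_Xn_poly.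
  have -> : T q = series_in_D c q + E.
    have -> : T q = T (q - 'X^n) + T 'X^n by rewrite linearB subrK.
    rewrite Tlow.
      by rewrite raddfB /= -/G -addrA; congr (_ + _); exact: addrC.
    apply/leq_sizeP => j; rewrite leq_eqVlt => /orP[/eqP <-|nj].
      by rewrite coefB qE coef_comp_XaddC_lead ?size_polyXn // subrr.
    have [_ sq _] := hXn n (- t).
    by rewrite coefB !nth_default ?subrr ?sq ?size_polyXn.
  rewrite qE series_in_D_comp comp_polyD -/G -comp_polyA.
  by rewrite comp_polyD comp_polyX comp_polyC rmorphN polyCN addrK comp_polyXr.
have /size1_polyC EC := hyperbolic_translates_const m2 s2 sE transl.
have E0 : E`_0 = 0.
  have := coef_series_in_D_Xn c (leqnn n); rewrite subnn => G0.
  rewrite coefB cE /G G0.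
  by rewrite ffactnn subrr.
by apply/eqP; rewrite -subr_eq0 -/E EC E0.
Qed.

End PreserversAreFunctionsOfD.

(** * Limits of real-rooted polynomials *)

Section LaguerrePolyaLimits.
Variable R : realType.
Implicit Types (s : seq R) (z : Cplx R).

(** With T the sum of the squares, |alpha k| <= 1 + T for all k, so one constant of [factor1_bound]
    serves for all factors and their distances to 1 are summable. *)
Lemma is_cvg_LP_product (alpha : nat -> R) z :
  cvgn (series (fun k => alpha k ^+ 2)) -> cvgn (LP_product alpha z).
Proof.
move=> ca; pose T := limn (series (fun k => alpha k ^+ 2)).
have a0 k : 0 <= alpha k ^+ 2 by exact: sqr_ge0.
have aT k : alpha k ^+ 2 <= T.
  apply: le_trans (series_le_limn k.+1 a0 ca).
  by rewrite seriesSr lerDr /series /= sumr_ge0.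
have [C [C0 HC]] := @factor1_bound R ((1 + T) * cabs z).
pose u k := (1 - toC (alpha k) * z) * expC (toC (alpha k) * z) - 1.
have -> : LP_product alpha z = fun n => \prod_(k < n) (1 + u k).
  apply/funext => n; apply: eq_bigr => k _; rewrite /u; ring.
apply: is_cvg_prod_1D.
apply: (@series_le_cvg _ _ (fun k => (C * cabs z ^+ 2) * alpha k ^+ 2)).
- by move=> k; exact: cabs_ge0.
- by move=> k; rewrite mulr_ge0 ?sqr_ge0 // mulr_ge0 ?exprn_ge0 ?cabs_ge0.
- move=> k; rewrite /u.
  have -> : C * cabs z ^+ 2 * alpha k ^+ 2 =
      C * cabs (toC (alpha k) * z) ^+ 2.
    by rewrite cabsM cabs_toC exprMn real_normK ?num_real //; ring.
  apply: HC; rewrite cabsM cabs_toC ler_wpM2r ?cabs_ge0 //.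
  have := aT k; rewrite -(real_normK (num_real (alpha k))).
  by have := normr_ge0 (alpha k); nra.
- exact: is_cvg_seriesZ.
Qed.

Definition LP_factor z (x : R) : Cplx R :=
  (1 - toC x * z) * expC (toC x * z).

(** The first N entries receive genus 1 factors, the others genus 2 factors. The compensating
    exponentials involve only the sum of all entries and the sum of squares of the tail; the latter
    becomes part of the Gaussian factor in the limit. *)
Lemma prod_split_exponentials s N z :
  \prod_(a <- s) (1 - toC a * z) =
  expC (- toC (\sum_(a <- s) a) * z) * \prod_(a <- take N s) LP_factor z a *
  expC (- toC (\sum_(a <- s) a ^+ 2 - \sum_(a <- take N s) a ^+ 2)
    * (z ^+ 2 / 2)) *
  \prod_(a <- drop N s)
     ((1 - toC a * z) * expC (toC a * z + (toC a * z) ^+ 2 / 2)).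
Proof.
rewrite -{1 2 4}(cat_take_drop N s) !big_cat /=.
set t := take N s; set d := drop N s.
rewrite addrAC subrr add0r /LP_factor !big_split /= -!expC_sum big_split /=.
have -> : \sum_(a <- t) toC a * z = toC (\sum_(a <- t) a) * z.
  by rewrite rmorph_sum mulr_suml.
have -> : \sum_(a <- d) (toC a * z) = toC (\sum_(a <- d) a) * z.
  by rewrite rmorph_sum mulr_suml.
have -> : \sum_(a <- d) ((toC a * z) ^+ 2 / 2) =
    toC (\sum_(a <- d) a ^+ 2) * (z ^+ 2 / 2).
  rewrite rmorph_sum mulr_suml; apply: eq_bigr => a _.
  by rewrite rmorphXn /= exprMn mulrA.
set A := \prod_(a <- t) _; set B := \prod_(a <- d) _.
rewrite rmorphD /=; set x := toC (\sum_(a <- t) a).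
set y := toC (\sum_(a <- d) a); set w := toC (\sum_(a <- d) a ^+ 2).
have E : expC (- (x + y) * z) * expC (x * z) * expC (- w * (z ^+ 2 / 2)) *
    (expC (y * z) * expC (w * (z ^+ 2 / 2))) = 1.
  by rewrite -!expCD -[RHS]expC0; congr expC; ring.
rewrite (expCD (y * z)); transitivity (A * B *
  (expC (- (x + y) * z) * expC (x * z) * expC (- w * (z ^+ 2 / 2)) *
   (expC (y * z) * expC (w * (z ^+ 2 / 2))))); last by ring.
by rewrite E mulr1.
Qed.

(** Beyond the end of [s] the default entry 0 gives the factor 1, so sequences of varying lengths
    can be compared index by index. *)
Lemma prod_take_nth s N z :
  \prod_(a <- take N s) LP_factor z a = \prod_(k < N) LP_factor z s`_k.
Proof.
elim: N s => [|N IH] s; first by rewrite take0 big_nil big_ord0.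
case: s => [|x s].
  rewrite big_nil big1 // => k _.
  by rewrite nth_nil /LP_factor rmorph0 mul0r subr0 expC0 mulr1.
by rewrite /= big_cons IH big_ord_recl.
Qed.

Lemma sum_take_nth s N :
  \sum_(a <- take N s) a ^+ 2 = \sum_(k < N) s`_k ^+ 2.
Proof.
elim: N s => [|N IH] s; first by rewrite take0 big_nil big_ord0.
case: s => [|x s].
  by rewrite big_nil big1 // => k _; rewrite nth_nil expr0n.
by rewrite /= big_cons IH big_ord_recl.
Qed.

(** Each factor differs from 1 by at most 200 |a z|^3 <= 200 |z|^3 delta a^2, and the a^2 add up to
    at most M. *)
Lemma prod_drop_sub1 s (M delta : R) N z : 0 <= delta ->
  (forall k, (N <= k)%N -> `|s`_k| <= delta) -> delta * cabs z <= 1 / 4 ->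
  \sum_(a <- s) a ^+ 2 <= M ->
  cabs (\prod_(a <- drop N s)
     ((1 - toC a * z) * expC (toC a * z + (toC a * z) ^+ 2 / 2)) - 1) <=
  expR (200 * M * cabs z ^+ 3 * delta) - 1.
Proof.
move=> d0 sd dz sM.
have nd a : a \in drop N s -> `|a| <= delta.
  by move=> /(nthP 0)[k _ <-]; rewrite nth_drop; apply: sd; exact: leq_addr.
pose u a := (1 - toC a * z) * expC (toC a * z + (toC a * z) ^+ 2 / 2) - 1.
have -> : \prod_(a <- drop N s)
     ((1 - toC a * z) * expC (toC a * z + (toC a * z) ^+ 2 / 2)) =
  \prod_(a <- drop N s) (1 + u a).
  by apply: eq_bigr => a _; rewrite /u; ring.
rewrite (le_trans (cabs_prod_sub1 _ _ _)) // lerB // ler_expR.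
apply: (@le_trans _ _
  (\sum_(a <- drop N s) 200 * cabs z ^+ 3 * delta * a ^+ 2)).
  rewrite big_seq [leRHS]big_seq; apply: ler_sum => a /nd ad.
  have c0 := cabs_ge0 z.
  have az : cabs (toC a * z) <= 1 / 4.
    by rewrite cabsM cabs_toC (le_trans _ dz) // ler_wpM2r.
  apply: (le_trans (factor2_near0 az)).
  have -> : 200 * cabs z ^+ 3 * delta * a ^+ 2 =
    200 * (a ^+ 2 * delta * cabs z ^+ 3) by ring.
  rewrite ler_wpM2l // cabsM cabs_toC exprMn ler_wpM2r ?exprn_ge0 //.
  by rewrite exprSr real_normK ?num_real // ler_wpM2l ?sqr_ge0.
rewrite -mulr_sumr.
have -> : 200 * M * cabs z ^+ 3 * delta = 200 * cabs z ^+ 3 * delta * M by ring.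
rewrite ler_wpM2l ?mulr_ge0 ?exprn_ge0 ?cabs_ge0 //.
apply: le_trans sM; rewrite -[s in leRHS](cat_take_drop N) big_cat /= lerDr.
by apply: sumr_ge0 => a _; exact: sqr_ge0.
Qed.

Lemma sum_nth_le s N : \sum_(k < N) s`_k ^+ 2 <= \sum_(a <- s) a ^+ 2.
Proof.
rewrite -sum_take_nth -[s in leRHS](cat_take_drop N) big_cat /= lerDl.
by apply: sumr_ge0 => a _; exact: sqr_ge0.
Qed.

Lemma cvg_LP_factor (T : Type) (F : set_system T) {FF : Filter F} z
    (x : T -> R) (l : R) :
  x t @[t --> F] --> l -> LP_factor z (x t) @[t --> F] --> LP_factor z l.
Proof.
move=> xl.
have xz : toC (x t) * z @[t --> F] --> toC l * z.
  by apply: cvgCM; [apply: cvg_toC; exact: xl|exact: cvg_cst].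
apply: cvgCM; last by apply: cvg_expC; exact: xz.
by apply: cvgCB; [exact: cvg_cst|exact: xz].
Qed.

Lemma cvg_prod_param (T : Type) (F : set_system T) {FF : Filter F}
    (f : T -> nat -> Cplx R) (h : nat -> Cplx R) N :
  (forall k, f t k @[t --> F] --> h k) ->
  \prod_(k < N) f t k @[t --> F] --> \prod_(k < N) h k.
Proof.
move=> fh; elim: N => [|N IH].
  by rewrite big_ord0; under eq_fun do rewrite big_ord0; exact: cvg_cst.
rewrite big_ord_recr; under eq_fun do rewrite big_ord_recr.
exact: (cvgCM IH (fh N)).
Qed.

(* The exponent a ^+ 2 of the Gaussian factor is half of the mass of the squares
   \sum_(x <- al n) x ^+ 2 that escapes to the tail: this mass tends to v, while
   the coordinatewise limits only retain \sum_k alpha k ^+ 2. *)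
Lemma LP_limit (al : nat -> seq R) (m v M : R) (phi : Cplx R -> Cplx R) :
  (forall n, \sum_(a <- al n) a = - m) ->
  (forall n, \sum_(a <- al n) a ^+ 2 <= M) ->
  \sum_(a <- al n) a ^+ 2 @[n --> \oo] --> v ->
  (forall n k, k.+1%:R * (al n)`_k ^+ 2 <= M) ->
  (forall z, \prod_(a <- al n) (1 - toC a * z) @[n --> \oo] --> phi z) ->
  exists a b alpha, LP_form a b alpha phi.
Proof.
move=> sum1 sum2 sum2v nthM prodphi.
have [U [PU ooU] Ulim] := ultrafilter_at_infinity R.
have M0 : 0 <= M.
  by apply: le_trans (sum2 0); apply: sumr_ge0 => a _; exact: sqr_ge0.
have /choice[alpha Halpha] k : exists l : R, (al n)`_k @[n --> U] --> l.
  apply: (Ulim (fun n => (al n)`_k) (Num.sqrt M)) => n.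
  rewrite -sqrtr_sqr ler_sqrt // (le_trans _ (nthM n k)) //.
  by rewrite ler_peMl ?sqr_ge0 // ler1n.
pose T N := series (fun k => alpha k ^+ 2) N.
have TE N : T N = \sum_(k < N) alpha k ^+ 2 by rewrite /T /series /= big_mkord.
have sumU N : \sum_(k < N) (al n)`_k ^+ 2 @[n --> U] --> T N.
  rewrite TE; elim: N => [|N IH].
    by rewrite big_ord0; under eq_fun do rewrite big_ord0; exact: cvg_cst.
  rewrite big_ord_recr; under eq_fun do rewrite big_ord_recr.
  by apply: cvgD => //=; under eq_fun do rewrite expr2; apply: cvgM.
have sum2U : \sum_(a <- al n) a ^+ 2 @[n --> U] --> v.
  by apply: cvg_trans sum2v; apply: cvg_app.
(* A Fatou inequality: squares may escape in the limit but none are created, so v - Tinf has a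
   square root. *)
have Tv N : T N <= v.
  have H : \sum_(a <- al n) a ^+ 2 - \sum_(k < N) (al n)`_k ^+ 2 @[n --> U] -->
      v - T N by apply: cvgB; [exact: sum2U|exact: sumU].
  rewrite -subr_ge0; apply: (cvgr_to_ge H); apply: nearW => n.
  by rewrite subr_ge0; exact: sum_nth_le.
have a0 k : 0 <= alpha k ^+ 2 by exact: sqr_ge0.
have Tnd : nondecreasing_seq T.
  by rewrite /T /series; apply/nondecreasing_series.
have cT : cvgn T.
  apply: nondecreasing_is_cvgn => //; exists v => _ [N _ <-]; exact: Tv.
pose Tinf := limn T.
have Tinfv : Tinf <= v by apply: limr_le => //; exact: nearW.
pose a := Num.sqrt ((v - Tinf) / 2).
have aE : a ^+ 2 = (v - Tinf) / 2.
  by rewrite sqr_sqrtr // divr_ge0 // subr_ge0.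
exists a, m, alpha; split=> // z; split; first exact: is_cvg_LP_product.
have /cvg_ex[L HL] := @is_cvg_LP_product alpha z cT.
rewrite (cvg_lim _ HL) //.
(* The limit along U of the split product deprived of its genus 2 tail. *)
pose Q N := expC (toC m * z) * LP_product alpha z N *
  expC (- toC (v - T N) * (z ^+ 2 / 2)).
have Qlim : Q N @[N --> \oo] -->
    expC (toC m * z) * L * expC (- toC (v - Tinf) * (z ^+ 2 / 2)).
  apply: cvgCM; first by apply: cvgCM; [exact: cvg_cst|exact: HL].
  apply: cvg_expC; apply: cvgCM; last exact: cvg_cst.
  under eq_fun do rewrite -rmorphN /=.
  rewrite -rmorphN /=; apply: cvg_toC; apply: cvgN.
  by apply: cvgB; [exact: cvg_cst|exact: cT].
have -> : expC (- toC a ^+ 2 * z ^+ 2 + toC m * z) * L =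
    expC (toC m * z) * L * expC (- toC (v - Tinf) * (z ^+ 2 / 2)).
  rewrite expCD.
  have -> : - toC (v - Tinf) * (z ^+ 2 / 2) = - toC a ^+ 2 * z ^+ 2.
    have -> : v - Tinf = 2 * a ^+ 2 by rewrite aE; field.
    by rewrite rmorphM rmorphXn rmorph_nat /=; field.
  by ring.
apply: (cvgC_unique _ Qlim).
(* By hypothesis (k + 1) times the square of entry k is at most M, so this bounds every entry of
   index at least N, uniformly in n. *)
pose delta N := Num.sqrt (M / N.+1%:R) : R.
have d0 N : 0 <= delta N by exact: sqrtr_ge0.
have nthd N n k : (N <= k)%N -> `|(al n)`_k| <= delta N.
  move=> Nk; rewrite -sqrtr_sqr ler_sqrt ?divr_ge0 //.
  rewrite ler_pdivlMr ?ltr0n // mulrC (le_trans _ (nthM n k)) //.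
  by rewrite ler_wpM2r ?sqr_ge0 // ler_nat ltnS.
have dlim : delta N @[N --> \oo] --> (0 : R).
  have H : M / N.+1%:R @[N --> \oo] --> (0 : R).
    by rewrite -(mulr0 M); apply: cvgM; [exact: cvg_cst|exact: cvg_harmonic].
  by rewrite -(@sqrtr0 R); exact: (cvg_comp _ _ H (@sqrt_continuous R 0)).
pose eps N := expR (200 * M * cabs z ^+ 3 * delta N) - 1.
have elim0 : eps N @[N --> \oo] --> (0 : R).
  have H : 200 * M * cabs z ^+ 3 * delta N @[N --> \oo] --> (0 : R).
    rewrite -(mulr0 (200 * M * cabs z ^+ 3)).
    by apply: cvgM; [exact: cvg_cst|exact: dlim].
  rewrite -(subrr (expR 0)) {2}expR0; apply: cvgB; last exact: cvg_cst.
  exact: (cvg_comp _ _ H (@continuous_expR R 0)).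
(* For fixed N the genus 2 tail costs a relative error [eps N] that does not depend on n; the limit
   along U comes first, then N tends to infinity. *)
have Hdist : \forall N \near \oo, cabs (Q N - phi z) <= cabs (Q N) * eps N.
  have : delta N * cabs z @[N --> \oo] --> (0 : R).
    by rewrite -(mul0r (cabs z)); apply: cvgM; [exact: dlim|exact: cvg_cst].
  have e4 : 0 < 1 / 4 :> R by lra.
  move=> /cvgr0_norm_le /(_ _ e4); apply: filterS => N.
  rewrite ger0_norm ?mulr_ge0 ?cabs_ge0 // => dz.
  pose q n := expC (toC m * z) * \prod_(k < N) LP_factor z (al n)`_k *
    expC (- toC (\sum_(a <- al n) a ^+ 2 - \sum_(k < N) (al n)`_k ^+ 2)
      * (z ^+ 2 / 2)).
  have qlim : q n @[n --> U] --> Q N.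
    apply: cvgCM; first apply: cvgCM; first exact: cvg_cst.
      apply: (@cvg_prod_param _ U _ (fun n k => LP_factor z (al n)`_k)
        (fun k => LP_factor z (alpha k))) => k.
      by apply: cvg_LP_factor; exact: Halpha.
    apply: cvg_expC; apply: cvgCM; last exact: cvg_cst.
    under eq_fun do rewrite -rmorphN /=.
    rewrite -rmorphN /=; apply: cvg_toC; apply: cvgN.
    by apply: cvgB; [exact: sum2U|exact: sumU].
  have phiU : \prod_(a <- al n) (1 - toC a * z) @[n --> U] --> phi z.
    by apply: cvg_trans (prodphi z); apply: cvg_app.
  have H1 := cvg_cabs (cvgCB qlim phiU).
  have H2 : cabs (q n) * eps N @[n --> U] --> cabs (Q N) * eps N.
    by apply: cvgM; [apply: cvg_cabs; exact: qlim|exact: cvg_cst].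
  have H3 : cabs (q n) * eps N - cabs (q n - \prod_(a <- al n) (1 - toC a * z))
      @[n --> U] --> cabs (Q N) * eps N - cabs (Q N - phi z).
    by apply: cvgB; [exact: H2|exact: H1].
  rewrite -subr_ge0; apply: (cvgr_to_ge H3); apply: nearW => n.
  rewrite subr_ge0 (prod_split_exponentials _ N) prod_take_nth sum_take_nth.
  rewrite sum1 rmorphN opprK -/(q n).
  set r := \prod_(a <- drop _ _) _.
  have -> : q n - q n * r = - (q n * (r - 1)) by ring.
  rewrite cabsN cabsM ler_wpM2l ?cabs_ge0 //.
  by apply: prod_drop_sub1 => // k; exact: nthd.
apply: (cvg_cabs_le Hdist).
have /cvg_cabs HQ := Qlim.
have := cvgM HQ elim0; rewrite mulr0; exact.
Qed.

End LaguerrePolyaLimits.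

(** * From preservers to Laguerre-Polya functions *)

Section LaguerrePolya.
Variable R : realType.
Implicit Types (rs s : seq R) (z : Cplx R) (c : nat -> Cplx R).

(** The k + 1 squares of index at most k are each at least the last of them. *)
Lemma decreasing_nth_sqr s (M : R) k :
  sorted (fun x y => `|y| <= `|x|) s -> \sum_(a <- s) a ^+ 2 <= M ->
  k.+1%:R * s`_k ^+ 2 <= M.
Proof.
move=> ss sM; apply: le_trans sM.
have [ks|sk] := ltnP k (size s); last first.
  rewrite nth_default // expr0n mulr0.
  by apply: sumr_ge0 => a _; exact: sqr_ge0.
apply: le_trans (sum_nth_le s k.+1).
have -> : k.+1%:R * s`_k ^+ 2 = \sum_(j < k.+1) s`_k ^+ 2.
  by rewrite sumr_const card_ord mulr_natl.
apply: ler_sum => j _.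
rewrite -[s`_k ^+ 2]real_normK ?num_real // -[s`_j ^+ 2]real_normK ?num_real //.
rewrite lerXn2r ?nnegrE //.
apply: (sorted_leq_nth _ _ _ ss) => //.
- by move=> y x t xy yt; exact: le_trans yt xy.
- by rewrite inE (leq_ltn_trans _ ks) // -ltnS.
- by rewrite -ltnS.
Qed.

Lemma cvg_div_harmonic (x : R) : x / n.+1%:R @[n --> \oo] --> (0 : R).
Proof.
by rewrite -(mulr0 x); apply: cvgM; [exact: cvg_cst|exact: cvg_harmonic].
Qed.

Lemma ffact_ratio_cvg k :
  (n.+1 ^_ k)%:R / n.+1%:R ^+ k @[n --> \oo] --> (1 : R).
Proof.
elim: k => [|k IH].
  by under eq_fun do rewrite ffactn0 expr0 divr1; exact: cvg_cst.
have H : 1 - k%:R / n.+1%:R @[n --> \oo] --> (1 - 0 : R).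
  by apply: cvgB; [exact: cvg_cst|exact: cvg_div_harmonic].
rewrite subr0 in H.
have H2 : (n.+1 ^_ k)%:R / n.+1%:R ^+ k * (1 - k%:R / n.+1%:R)
    @[n --> \oo] --> (1 * 1 : R) by apply: cvgM; [exact: IH|exact: H].
rewrite mulr1 in H2; apply: cvg_trans H2.
(* From k <= n on, the subtraction of natural numbers in the falling factorial is not truncated. *)
apply: near_eq_cvg; exists k => // n /= kn.
rewrite ffactnSr natrM natrB; last exact: leqW.
rewrite exprS; field.
by rewrite expf_neq0 ?pnatr_eq0 // addrC natr1 pnatr_eq0.
Qed.

Lemma ffact_le_expn n k : (n ^_ k <= n ^ k)%N.
Proof.
elim: k => [|k IH]; first by rewrite ffactn0 expn0.
by rewrite ffactnSr expnSr leq_mul // leq_subr.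
Qed.

Lemma preserves_hyperbolicity_moments c : preserves_hyperbolicity c ->
  exists m v : R, c 1 = toC m /\ c 1 ^+ 2 - 2 * c 2 = toC v.
Proof.
move=> hc.
have r1 := preserves_hyperbolicity_real 1 hc.
have r2 := preserves_hyperbolicity_real 2 hc.
exists (complex.Re (c 1)), (complex.Re (c 1 ^+ 2 - 2 * c 2)).
by rewrite /toC !RRe_real // realB ?realX ?realM.
Qed.

Lemma moments_bounded c (m v : R) : c 1 = toC m -> c 1 ^+ 2 - 2 * c 2 = toC v ->
  c 1 ^+ 2 <= toC (m ^+ 2 + `|v|) /\ c 1 ^+ 2 - 2 * c 2 <= toC (m ^+ 2 + `|v|).
Proof.
move=> c1 ->; rewrite c1 -rmorphXn /= !le_toC.
have := ler_norm v; have := sqr_ge0 m; have := normr_ge0 v.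
by split; lra.
Qed.

Lemma preserves_hyperbolicity_entire c z : preserves_hyperbolicity c ->
  cvgn (series (fun k => c k * z ^+ k)).
Proof.
move=> hc; have [m [v [c1 c2]]] := preserves_hyperbolicity_moments hc.
have [M1 M2] := moments_bounded c1 c2.
have [g cg Hg] := coef_majorant (m ^+ 2 + `|v|) (cabs_ge0 z).
by apply: (is_cvg_series_cabs _ cg) => k; rewrite cabsM cabsX; exact: Hg.
Qed.

(* The polynomials recip_prod (rs n) rescaled by n.+1 are the Jensen polynomials
   of phi; they converge to phi by dominated convergence. *)
Lemma preserves_hyperbolicity_LP_form c (phi : Cplx R -> Cplx R) :
  preserves_hyperbolicity c -> power_series_expansion phi c ->
  exists a b alpha, LP_form a b alpha phi.
Proof.
move=> hc Hphi; have [m [v [c1 c2]]] := preserves_hyperbolicity_moments hc.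
have [M1 M2] := moments_bounded c1 c2.
set M := m ^+ 2 + `|v| in M1 M2.
have /choice[rs Hrs] n := preserved_Xn n.+1 hc.
(* Sorting by decreasing modulus makes the entries of large index small uniformly in n, which
   coordinatewise limits require. *)
pose al n := sort (fun x y => `|y| <= `|x|) [seq r / n.+1%:R | r <- rs n].
have alE (S : nmodType) (f : R -> S) n :
    \sum_(a <- al n) f a = \sum_(r <- rs n) f (r / n.+1%:R).
  by rewrite (perm_big [seq r / n.+1%:R | r <- rs n]) ?big_map ?perm_sort.
have n0 n : (n.+1%:R : R) != 0 by rewrite pnatr_eq0.
have n0c n : (n.+1%:R : Cplx R) != 0 by rewrite pnatr_eq0.
have S1 n : \sum_(a <- al n) a = - m.
  have [rsn _ Hn] := Hrs n; have [H _] := sum_sqr_roots rsn Hn.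
  rewrite alE -mulr_suml; apply: (@toC_inj R).
  rewrite rmorphM /= H c1 fmorphV rmorphN /= rmorph_nat.
  by rewrite mulNr mulfK.
have S2 n : \sum_(a <- al n) a ^+ 2 = v + (m ^+ 2 - v) / n.+1%:R.
  have [rsn _ Hn] := Hrs n; have [_ H] := sum_sqr_roots rsn Hn.
  rewrite alE; under eq_bigr do rewrite exprMn.
  rewrite -mulr_suml; apply: (@toC_inj R).
  rewrite rmorphM /= H c2 c1 rmorphD rmorphM rmorphB !rmorphXn !fmorphV /=.
  rewrite rmorph_nat -[n.+1%:R in LHS]natr1 -[n.+1%:R in RHS]natr1.
  by field; rewrite natr1.
have S2M n : \sum_(a <- al n) a ^+ 2 <= M.
  rewrite S2 /M.
  have i0 : 0 <= (n.+1%:R : R)^-1 by rewrite invr_ge0.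
  have i1 : (n.+1%:R : R)^-1 <= 1 by rewrite invf_le1 ?ltr0n // ler1n.
  move: i0 i1; set i := _^-1; set w := m ^+ 2 => i0 i1.
  have h0 : 0 <= 1 - i by rewrite subr_ge0.
  have h1 : 0 <= (`|v| - v) * (1 - i) by rewrite mulr_ge0 // subr_ge0 ler_norm.
  have h2 : 0 <= w * (1 - i) by rewrite mulr_ge0 // sqr_ge0.
  have h3 : 0 <= `|v| * i by rewrite mulr_ge0.
  by lra.
apply: (@LP_limit R al m v M phi) => //.
- under eq_fun do rewrite S2.
  have H : v + (m ^+ 2 - v) / n.+1%:R @[n --> \oo] --> v + 0.
    by apply: cvgD; [exact: cvg_cst|exact: cvg_div_harmonic].
  by rewrite addr0 in H.
- move=> n k; apply: decreasing_nth_sqr => //.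
  by apply: sort_sorted => x y; exact: le_total.
move=> z.
have [g cg Hg] := coef_majorant M (cabs_ge0 z).
(* The terms of the rescaled polynomial at z: the ratio lies between 0 and 1, hence the domination,
   and tends to 1 for fixed k. *)
pose f n k := c k * z ^+ k * toC ((n.+1 ^_ k)%:R / n.+1%:R ^+ k).
apply: (@tannery R nat \oo _ f (fun k => c k * z ^+ k) g) => //.
- move=> n k; rewrite /f cabsM.
  have t0 : 0 <= (n.+1 ^_ k)%:R / n.+1%:R ^+ k :> R.
    by rewrite divr_ge0 ?exprn_ge0.
  have t1 : (n.+1 ^_ k)%:R / n.+1%:R ^+ k <= 1 :> R.
    by rewrite ler_pdivrMr ?exprn_gt0 // mul1r -natrX ler_nat ffact_le_expn.
  rewrite cabs_toC ger0_norm // (le_trans _ (Hg c k hc M1 M2)) //.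
  by rewrite -cabsX -cabsM ler_piMr ?cabs_ge0.
- move=> k; rewrite -[X in _ --> X]mulr1 -(rmorph1 (@toC R)).
  apply: cvgCM; first exact: cvg_cst.
  by apply: cvg_toC; exact: ffact_ratio_cvg.
move=> n; have [rsn _ Hn] := Hrs n.
have -> : \prod_(a <- al n) (1 - toC a * z) = (recip_prod (rs n)).[z / n.+1%:R].
  rewrite (perm_big [seq r / n.+1%:R | r <- rs n]) ?perm_sort // big_map.
  rewrite horner_recip_prod; apply: eq_bigr => r _.
  by rewrite rmorphM fmorphV rmorph_nat mulrA mulrAC.
apply: cvg_near_cst; exists n.+2 => // k /= nk.
have sk : (size (recip_prod (rs n)) <= k)%N.
  by rewrite (leq_trans (size_recip_prod _)) // rsn.
rewrite (horner_coef_wide _ sk) /series /= big_mkord.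
apply: eq_bigr => i _; rewrite Hn /f exprMn exprVn.
by rewrite rmorphM fmorphV rmorphXn /= !rmorph_nat; ring.
Qed.

Lemma preserves_hyperbolicity_LP c : preserves_hyperbolicity c ->
  exists (phi : Cplx R -> Cplx R) a b alpha, [/\ real_entire phi,
    LP_form a b alpha phi & power_series_expansion phi c].
Proof.
move=> hc; pose phi z := limn (series (fun k => c k * z ^+ k)).
have Hphi : power_series_expansion phi c.
  by move=> z; exact: preserves_hyperbolicity_entire.
have [a [b [alpha H]]] := preserves_hyperbolicity_LP_form hc Hphi.
exists phi, a, b, alpha; split=> //; split; first by exists c.
move=> x; pose u n := series (fun k => c k * toC x ^+ k) n.
have HI : complex.Im (u n) @[n --> \oo] --> complex.Im (phi (toC x)).
  by apply: cvg_Im; exact: Hphi.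
have u0 : (fun n => complex.Im (u n)) = fun=> 0.
  apply/funext => n; have /complex_realP[y ->] // : u n \is Num.real.
  apply: rpred_sum => k _; rewrite realM ?realX ?toC_real //.
  exact: preserves_hyperbolicity_real.
rewrite u0 in HI.
have : complex.Im (phi (toC x)) = 0.
  by apply: (cvg_unique _ HI); [exact: Rhausdorff|exact: cvg_cst].
by case: (phi (toC x)) => p q /= ->; rewrite complex_real.
Qed.

End LaguerrePolya.

(** * Operators of Laguerre-Polya functions *)

Section LaguerrePolyaOperators.
Variable R : realType.
Implicit Types (z : Cplx R) (c d : nat -> Cplx R).

Lemma geometric_tail (x : R) n m : 0 <= x <= 1 / 2 -> (n <= m)%N ->
  series (fun k => x ^+ k) m - series (fun k => x ^+ k) n <=
  2 * (x ^+ n - x ^+ m).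
Proof.
move=> /andP[x0 x2]; elim: m => [|m IH].
  by rewrite leqn0 => /eqP ->; rewrite !subrr mulr0.
rewrite leq_eqVlt => /orP[/eqP ->|]; first by rewrite !subrr mulr0.
rewrite ltnS => /IH; rewrite seriesSr exprS.
have : 0 <= x ^+ m by rewrite exprn_ge0.
by nra.
Qed.

(** Convergence at z = 1 bounds the d k by some K. If d k is the first nonzero coefficient, then at
    a small x > 0 the term |d k| x^k exceeds the rest, which is at most 2 K x^(k + 1). *)
Lemma power_series_eq0 d :
  (forall z, series (fun k => d k * z ^+ k) @ \oo --> (0 : Cplx R)) ->
  forall k, d k = 0.
Proof.
move=> H.
have [K K0 HK] : exists2 K : R, 0 <= K & forall k, cabs (d k) <= K.
  have d0 : d k @[k --> \oo] --> (0 : Cplx R).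
    have -> : d = fun k => series (fun k => d k * 1 ^+ k) k.+1 -
        series (fun k => d k * 1 ^+ k) k.
      by apply/funext => k; rewrite seriesSr expr1n mulr1; ring.
    rewrite -(subrr (0 : Cplx R)); apply: cvgCB; last exact: H.
    have H1 := H 1; rewrite -cvg_shiftS in H1; exact: H1.
  have /cvg_cabs := d0; rewrite cabs0 => /cvgP/cvg_seq_bounded.
  move=> /pinfty_ex_gt0[K K0 HK]; exists K => [|k]; first exact: ltW.
  apply: le_trans (HK k I).
  exact: ler_norm.
elim/ltn_ind => k IH; apply/eqP; rewrite -cabs_eq0 eq_le cabs_ge0 andbT leNgt.
apply/negP; set e := cabs (d k) => e0.
(* D > 2 e ensures x <= 1 / 2 for the geometric tail, and D > 4 K ensures 2 K x < e. *)
pose D := 4 * K + 2 * e + 1; pose x := e / D.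
have D0 : 0 < D by rewrite /D; lra.
have x0 : 0 < x by rewrite divr_gt0.
have xD : x * D = e by rewrite /x divfK ?gt_eqF.
have x2 : x <= 1 / 2 by rewrite /D in xD; nra.
have Sk : series (fun j => d j * toC x ^+ j) k.+1 = d k * toC x ^+ k.
  rewrite /series /= big_mkord big_ord_recr /= big1 ?add0r // => j _.
  by rewrite IH ?mul0r.
have tail m : (k < m)%N -> e * x ^+ k - 2 * K * x ^+ k.+1 <=
    cabs (series (fun j => d j * toC x ^+ j) m).
  move=> km.
  have H1 := @cabs_series_tail R (fun j => d j * toC x ^+ j)
    (K *: (fun j => x ^+ j)) k.+1 m km.
  have {}H1 : cabs (series (fun j => d j * toC x ^+ j) m -
      series (fun j => d j * toC x ^+ j) k.+1) <= 2 * K * x ^+ k.+1.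
    apply: le_trans (H1 _) _ => [j|].
      rewrite cabsM cabsX cabs_toC (ger0_norm (ltW x0)).
      by rewrite ler_wpM2r ?exprn_ge0 // ltW.
    have x02 : 0 <= x <= 1 / 2 by rewrite (ltW x0).
    have H2 := geometric_tail x02 km.
    have xm : 0 <= x ^+ m by rewrite exprn_ge0 // ltW.
    rewrite seriesZ /= -mulrBr.
    have : K * (series (fun k => x ^+ k) m - series (fun k => x ^+ k) k.+1) <=
      K * (2 * (x ^+ k.+1 - x ^+ m)) by rewrite ler_wpM2l.
    move/le_trans; apply.
    have -> : 2 * K * x ^+ k.+1 = K * (2 * x ^+ k.+1) by ring.
    by rewrite ler_wpM2l //; lra.
  have : e * x ^+ k = cabs (series (fun j => d j * toC x ^+ j) k.+1).
    by rewrite Sk cabsM cabsX cabs_toC ger0_norm // ltW.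
  move=> ->.
  have := cabsB (series (fun j => d j * toC x ^+ j) m)
    (series (fun j => d j * toC x ^+ j) m -
     series (fun j => d j * toC x ^+ j) k.+1).
  set A := series _ m; set B := series _ k.+1 in H1 *.
  have -> : A - (A - B) = B by ring.
  by move: H1; lra.
have H0 : cabs (series (fun j => d j * toC x ^+ j) m) @[m --> \oo] --> (0 : R).
  by rewrite -(@cabs0 R); apply: cvg_cabs; exact: H.
have : e * x ^+ k - 2 * K * x ^+ k.+1 <= 0.
  by apply: (cvgr_to_ge H0); exists k.+1 => // m /=; exact: tail.
rewrite exprS.
have -> : e * x ^+ k - 2 * K * (x * x ^+ k) = (e - 2 * K * x) * x ^+ k by ring.
rewrite pmulr_lle0 ?exprn_gt0 //; rewrite /D in xD; nra.
Qed.

Lemma power_series_unique c d (phi : Cplx R -> Cplx R) :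
  power_series_expansion phi c -> power_series_expansion phi d -> c = d.
Proof.
move=> Hc Hd; apply/funext => k; apply/eqP; rewrite -subr_eq0; apply/eqP.
apply: (@power_series_eq0 (fun k => c k - d k)) => z.
have -> : series (fun k => (c k - d k) * z ^+ k) =
    fun n => series (fun k => c k * z ^+ k) n -
      series (fun k => d k * z ^+ k) n.
  apply/funext => n; rewrite /series /= -sumrB; apply: eq_bigr => j _; ring.
by rewrite -(subrr (phi z)); apply: cvgCB; [exact: Hc|exact: Hd].
Qed.

(** A product of M factors (1 - w) exp w, each at distance O(|w|^2) from 1. Unlike the usual limit
    of (1 - x / M)^M, this relative form allows M w to be unbounded. *)
Lemma compound_limit (M : nat -> nat) (w : nat -> Cplx R) :
  (forall n, (0 < M n)%N) ->
  (M n)%:R * cabs (w n) ^+ 2 @[n --> \oo] --> (0 : R) ->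
  (1 - w n) ^+ M n * expC (w n *+ M n) @[n --> \oo] --> (1 : Cplx R).
Proof.
move=> M0 H.
have H23 : expR (23 * ((M n)%:R * cabs (w n) ^+ 2)) - 1
    @[n --> \oo] --> (0 : R).
  have H1 : 23 * ((M n)%:R * cabs (w n) ^+ 2) @[n --> \oo] --> (0 : R).
    by rewrite -(mulr0 (23 : R)); apply: cvgM; [exact: cvg_cst|exact: H].
  rewrite -(subrr (expR 0)) {2}expR0; apply: cvgB; last exact: cvg_cst.
  exact: (cvg_comp _ _ H1 (@continuous_expR R 0)).
apply: cvg_cabs_le H23.
have e4 : 0 < 1 / 4 :> R by lra.
move/cvgr0_norm_le : H => /(_ _ e4); apply: filterS => n.
have c0 := cabs_ge0 (w n).
rewrite ger0_norm ?mulr_ge0 ?exprn_ge0 // => Hn.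
have M1 : 1 <= (M n)%:R :> R by rewrite ler1n.
have w2 : cabs (w n) <= 1 / 2 by nra.
rewrite expCMn -exprMn.
have -> : (1 - w n) * expC (w n) = 1 + ((1 - w n) * expC (w n) - 1) by ring.
set u := (1 - w n) * _ - 1.
have -> : (1 + u) ^+ M n = \prod_(k < M n) (1 + u).
  by rewrite prodr_const card_ord.
rewrite (le_trans (cabs_prod_sub1 _ _ _)) // lerB // ler_expR.
rewrite sumr_const card_ord -[cabs u *+ _]mulr_natl [leRHS]mulrCA ler_wpM2l //.
exact: factor1_near0.
Qed.

(* Reciprocals of the zeros of a polynomial approximating phi: the three blocks
   after the alpha k stand for (1 + s z / M) ^+ M, close to expC (s z), with
   s = b + \sum_(k < N) alpha k, and for
   (1 - a ^+ 2 z ^+ 2 / N.+1) ^+ N.+1, close to expC (- a ^+ 2 z ^+ 2). *)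
Definition LP_approx (a b : R) (alpha : nat -> R) (M : nat -> nat) (N : nat) :
    seq R :=
  mkseq alpha N ++
  nseq (M N) (- ((b + \sum_(k < N) alpha k) / (M N)%:R)) ++
  nseq N.+1 (a / Num.sqrt N.+1%:R) ++ nseq N.+1 (- (a / Num.sqrt N.+1%:R)).

Lemma big_mkseq (S : Type) (idx : S) (op : S -> S -> S) (f : R -> S)
    (alpha : nat -> R) N :
  \big[op/idx]_(x <- mkseq alpha N) f x = \big[op/idx]_(k < N) f (alpha k).
Proof.
rewrite /mkseq big_map.
have -> : iota 0 N = index_iota 0 N by rewrite /index_iota subn0.
by rewrite big_mkord.
Qed.

(** The block of [M N] equal entries makes the coefficient of z equal to b for every N, although the
    sum of the alpha k may diverge. *)
Lemma sum_LP_approx (a b : R) (alpha : nat -> R) M N : (0 < M N)%N ->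
  \sum_(x <- LP_approx a b alpha M N) x = - b.
Proof.
move=> M0; rewrite /LP_approx; move: N.+1 => n1.
rewrite !big_cat /= big_mkseq !big_nseq !iter_addr_0 -mulrnDl subrr.
rewrite mul0rn addr0 mulNrn -[_ / _ *+ _]mulr_natr divfK.
  by ring.
by rewrite pnatr_eq0 -lt0n.
Qed.

Lemma sumsq_LP_approx (a b : R) (alpha : nat -> R) M N : (0 < M N)%N ->
  \sum_(x <- LP_approx a b alpha M N) x ^+ 2 =
  \sum_(k < N) alpha k ^+ 2 + (b + \sum_(k < N) alpha k) ^+ 2 / (M N)%:R +
  2 * a ^+ 2.
Proof.
move=> M0; rewrite /LP_approx.
have n0 : N.+1%:R != 0 :> R by rewrite pnatr_eq0.
move: N.+1 n0 => n1 n0.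
rewrite !big_cat /= big_mkseq !big_nseq !iter_addr_0 !sqrrN.
have m0 : (M N)%:R != 0 :> R by rewrite pnatr_eq0 -lt0n.
have E1 (x : R) : (x / (M N)%:R) ^+ 2 *+ M N = x ^+ 2 / (M N)%:R.
  by rewrite -[LHS]mulr_natr; field.
have E2 : (a / Num.sqrt n1%:R) ^+ 2 *+ n1 = a ^+ 2.
  rewrite -[LHS]mulr_natr exprMn exprVn sqr_sqrtr ?ler0n //.
  by rewrite divfK.
by rewrite E1 E2; ring.
Qed.

Lemma prod_LP_approx (a b : R) (alpha : nat -> R) M N z : (0 < M N)%N ->
  let s := b + \sum_(k < N) alpha k in
  let w1 := - (toC (s / (M N)%:R) * z) in
  let w2 := toC (a ^+ 2 / N.+1%:R) * z ^+ 2 in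
  \prod_(x <- LP_approx a b alpha M N) (1 - toC x * z) =
  LP_product alpha z N * ((1 - w1) ^+ M N * expC (w1 *+ M N)) *
  ((1 - w2) ^+ N.+1 * expC (w2 *+ N.+1)) *
  expC (- toC a ^+ 2 * z ^+ 2 + toC b * z).
Proof.
move=> M0 s w1 w2; rewrite {}/w2 /LP_approx.
have n0 : N.+1%:R != 0 :> R by rewrite pnatr_eq0.
move: N.+1 n0 => n1 n0; set w2 := toC (a ^+ 2 / _) * _.
rewrite !big_cat /= !big_nseq !iter_mulr_1 big_mkseq -exprMn.
have -> : (1 - toC (a / Num.sqrt n1%:R) * z) *
    (1 - toC (- (a / Num.sqrt n1%:R)) * z) = 1 - w2.
  have -> : w2 = toC (a / Num.sqrt n1%:R) ^+ 2 * z ^+ 2.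
    by rewrite /w2 -rmorphXn /= exprMn exprVn sqr_sqrtr.
  by rewrite rmorphN /=; ring.
have -> : 1 - toC (- (s / (M N)%:R)) * z = 1 - w1.
  by rewrite /w1 rmorphN mulNr.
have m0 : (M N)%:R != 0 :> R by rewrite pnatr_eq0 -lt0n.
have -> : w1 *+ M N = - (toC s * z).
  rewrite /w1 mulNrn -mulrnAl -rmorphMn /= -[s / _ *+ _]mulr_natr divfK //.
have -> : w2 *+ n1 = toC a ^+ 2 * z ^+ 2.
  rewrite /w2 -mulrnAl -rmorphMn /= -[_ / _ *+ _]mulr_natr divfK //.
  by rewrite rmorphXn.
rewrite /LP_product big_split /= -expC_sum -mulr_suml -rmorph_sum /=.
set S := \sum_(k < N) alpha k.
have E : expC (toC S * z) * expC (- (toC s * z)) * expC (toC a ^+ 2 * z ^+ 2) *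
    expC (- toC a ^+ 2 * z ^+ 2 + toC b * z) = 1.
  rewrite -!expCD -[RHS]expC0; congr expC.
  by rewrite /s rmorphD /= -/S; ring.
set A := \prod_(k < N) _; set B := (1 - w1) ^+ _; set C := (1 - w2) ^+ _.
transitivity (A * B * C * (expC (toC S * z) * expC (- (toC s * z)) *
  expC (toC a ^+ 2 * z ^+ 2) * expC (- toC a ^+ 2 * z ^+ 2 + toC b * z))).
  by rewrite E; ring.
by ring.
Qed.

Lemma prod_LP_approx_cvg (a b : R) (alpha : nat -> R) (M : nat -> nat) z L :
  (forall N, (0 < M N)%N) ->
  (forall N, (b + \sum_(k < N) alpha k) ^+ 2 * N.+1%:R <= (M N)%:R) ->
  LP_product alpha z @ \oo --> L ->
  \prod_(x <- LP_approx a b alpha M N) (1 - toC x * z) @[N --> \oo] -->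
  expC (- toC a ^+ 2 * z ^+ 2 + toC b * z) * L.
Proof.
move=> M0 MN HL.
pose w1 N := - (toC ((b + \sum_(k < N) alpha k) / (M N)%:R) * z).
pose w2 N := toC (a ^+ 2 / N.+1%:R) * z ^+ 2.
pose e := expC (- toC a ^+ 2 * z ^+ 2 + toC b * z).
have -> : (fun N => \prod_(x <- LP_approx a b alpha M N) (1 - toC x * z)) =
  fun N => LP_product alpha z N * ((1 - w1 N) ^+ M N * expC (w1 N *+ M N)) *
    ((1 - w2 N) ^+ N.+1 * expC (w2 N *+ N.+1)) * e.
  by apply/funext => N; rewrite prod_LP_approx.
have -> : e * L = L * 1 * 1 * e by ring.
apply: cvgCM; last exact: cvg_cst.
apply: cvgCM; last first.
  apply: (@compound_limit S w2) => //; rewrite /w2.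
  have -> : (fun N => N.+1%:R * cabs (toC (a ^+ 2 / N.+1%:R) * z ^+ 2) ^+ 2) =
      fun N => (a ^+ 2 * cabs z ^+ 2) ^+ 2 / N.+1%:R.
    apply/funext => N; rewrite cabsM cabsX cabs_toC.
    rewrite ger0_norm ?divr_ge0 ?sqr_ge0 //.
    have n0 : N.+1%:R != 0 :> R by rewrite pnatr_eq0.
    by move: N.+1%:R n0 => n n0; field.
  exact: cvg_div_harmonic.
apply: cvgCM; first exact: HL.
apply: (@compound_limit M w1) => //; rewrite /w1.
apply: (squeeze_cvg0 _ (cvg_div_harmonic (cabs z ^+ 2))); apply: nearW => N.
have m0 : 0 < (M N)%:R :> R by rewrite ltr0n.
rewrite mulr_ge0 ?sqr_ge0 //= cabsN cabsM cabs_toC exprMn.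
rewrite real_normK ?num_real //; move: (MN N); set s := b + _.
move=> H.
have -> : (M N)%:R * ((s / (M N)%:R) ^+ 2 * cabs z ^+ 2) =
   (s ^+ 2 / (M N)%:R) * cabs z ^+ 2.
  by move: (M N)%:R m0 {H} => m m0; field; rewrite gt_eqF.
rewrite mulrC ler_wpM2l ?sqr_ge0 // ler_pdivrMr //.
by rewrite mulrC ler_pdivlMr ?ltr0n.
Qed.

Lemma LP_form_preserves_hyperbolicity (phi : Cplx R -> Cplx R) a b alpha c :
  LP_form a b alpha phi -> power_series_expansion phi c ->
  preserves_hyperbolicity c.
Proof.
move=> [ca Hphi] Hc.
pose s N := b + \sum_(k < N) alpha k.
(* As s N may be unbounded, M N must outgrow its square: the block then adds at most 1 / (N + 1) to
   the sum of squares, and its product is asymptotic to the exponential. *)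
have /choice[M HM] N : exists m : nat, (0 < m)%N /\ s N ^+ 2 * N.+1%:R <= m%:R.
  have x0 : 0 <= s N ^+ 2 * N.+1%:R by rewrite mulr_ge0 ?sqr_ge0.
  have := archi_boundP x0 => H.
  exists (Num.bound (s N ^+ 2 * N.+1%:R)); split; last exact: ltW.
  by rewrite -(@ltr0n R); exact: le_lt_trans H.
have M0 N : (0 < M N)%N by case: (HM N).
pose T := limn (series (fun k => alpha k ^+ 2)).
pose cs N k := (recip_prod (LP_approx a b alpha M N))`_k.
have hcs N : preserves_hyperbolicity (cs N).
  exact: preserves_hyperbolicity_recip_prod.
pose B := b ^+ 2 + T + 1 + 2 * a ^+ 2.
have aT N : \sum_(k < N) alpha k ^+ 2 <= T.
  have := @series_le_limn R (fun k => alpha k ^+ 2) N (fun k => sqr_ge0 _) ca.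
  by rewrite /series /= big_mkord.
have T0 : 0 <= T by have := aT 0; rewrite big_ord0.
have B1 N : cs N 1 ^+ 2 <= toC B.
  rewrite /cs coef1_recip_prod sum_LP_approx // rmorphN opprK.
  rewrite -rmorphXn /= le_toC /B; have := sqr_ge0 a; lra.
have B2 N : cs N 1 ^+ 2 - 2 * cs N 2 <= toC B.
  rewrite /cs coef2_recip_prod sumsq_LP_approx // le_toC /B.
  have [m0 H] := HM N; rewrite -/(s N).
  have : s N ^+ 2 / (M N)%:R <= 1.
    rewrite ler_pdivrMr ?ltr0n // mul1r (le_trans _ H) //.
    by rewrite ler_peMr ?sqr_ge0 // ler1n.
  have := aT N; have := sqr_ge0 b; lra.
have [U [PU ooU] Ulim] := ultrafilter_at_infinity R.
(* With rho = 1 the majorant bounds each coefficient uniformly in N. The coefficients are real, so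
   limits of their real parts along U suffice. *)
have [g1 _ Hg1] := coef_majorant B (@ler01 R).
have /choice[d Hd] k : exists l : R, complex.Re (cs N k) @[N --> U] --> l.
  apply: (Ulim (fun N => complex.Re (cs N k)) (g1 k)) => N.
  rewrite (le_trans (Re_le_cabs _)) //.
  by have := Hg1 (cs N) k (hcs N) (B1 N) (B2 N); rewrite expr1n mulr1.
pose c' k := toC (d k).
have cslim k : cs N k @[N --> U] --> c' k.
  have -> : (fun N => cs N k) = fun N => toC (complex.Re (cs N k)).
    by apply/funext => N; rewrite /toC RRe_real // recip_prod_real.
  by apply: cvg_toC; exact: Hd.
have hc' : preserves_hyperbolicity c'.
  exact: (preserves_hyperbolicity_lim hcs cslim).
(* Both expansions being of phi, c' is c, and preservation passes from c' to c. *)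
suff Hc' : power_series_expansion phi c'.
  by rewrite (power_series_unique Hc Hc').
move=> z.
have [g cg Hg] := coef_majorant B (cabs_ge0 z).
have [l Hl] : exists l : Cplx R, series (fun k => c' k * z ^+ k) @ \oo --> l.
  have /cvg_ex[l Hl] := @preserves_hyperbolicity_entire R c' z hc'.
  by exists l; exact: Hl.
have Pl : (recip_prod (LP_approx a b alpha M N)).[z] @[N --> U] --> l.
  apply: (@tannery R nat U _ (fun N k => cs N k * z ^+ k)
    (fun k => c' k * z ^+ k) g _ l _ cg _ _ Hl).
  - by move=> N k; rewrite cabsM cabsX; exact: Hg.
  - by move=> k; apply: cvgCM; [exact: cslim|exact: cvg_cst].
  move=> N; apply: cvg_near_cst.
  exists (size (recip_prod (LP_approx a b alpha M N))) => // k /= sk.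
  by rewrite (horner_coef_wide _ sk) /series /= big_mkord.
have [cL phiz] := Hphi z.
have Pphi : (recip_prod (LP_approx a b alpha M N)).[z] @[N --> U] --> phi z.
  have : (recip_prod (LP_approx a b alpha M N)).[z] @[N --> \oo] --> phi z.
    rewrite phiz; under eq_fun do rewrite horner_recip_prod.
    by apply: (prod_LP_approx_cvg M0 _ cL) => N; have [_] := HM N.
  by apply: cvg_trans; apply: cvg_app.
by rewrite (cvgC_unique Pphi Pl).
Qed.

End LaguerrePolyaOperators.

(** * The characterisation and the commutative monoid *)

Lemma monic_preserver_series_in_D (R : realType)
    (T : {poly Cplx R} -> {poly Cplx R}) :
  @monic_preservers R T -> exists2 c, preserves_hyperbolicity c &
    T = series_in_D c.
Proof.
move=> HT; have [linT _] := HT 0 I.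
pose T' : {linear {poly Cplx R} -> {poly Cplx R}} :=
  HB.pack T (GRing.isLinear.Build _ _ _ _ T linT).
have [c [hc Tc]] := @preserver_series_in_D R T' HT.
by exists c => //; apply/funext.
Qed.

Theorem theorem7 (R : realType) :
  (forall T : {linear {poly Cplx R} -> {poly Cplx R}},
     @monic_preservers R T <->
     exists (phi : Cplx R -> Cplx R) (a b : R) (alpha : nat -> R),
       [/\ real_entire phi, LP_form a b alpha phi & is_function_of_D phi T]) /\
  commutative_monoid (@monic_preservers R)
    (fun S T : {poly Cplx R} -> {poly Cplx R} => S \o T) idfun.
Proof.
split=> [T|].
  split=> [/monic_preserver_series_in_D[c hc Tc]|].
    have [phi [a [b [alpha [re lp ex]]]]] := preserves_hyperbolicity_LP hc.
    by exists phi, a, b, alpha; split=> //; exists c; split=> // p; rewrite Tc.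
  move=> [phi [a [b [alpha [_ lp [c [ex Tc]]]]]]] n _.
  split=> [|_ [p hp <-]]; first exact: linearP.
  by rewrite Tc; exact: (LP_form_preserves_hyperbolicity lp ex).
split=> //.
- move=> S T HS HT n _; have [linS imS] := HS n I; have [linT imT] := HT n I.
  split=> [x p q|_ [p hp <-]]; first by rewrite /= linT linS.
  by apply: imS; exists (T p) => //; apply: imT; exists p.
- move=> S T /monic_preserver_series_in_D[c _ ->].
  move=> /monic_preserver_series_in_D[d _ ->].
  by apply/funext => p; exact: series_in_D_comm.
Qed.
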